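(* Let $k\ge2$, assume that $\lambda=\lambda_1=\cdots=\lambda_{k-1}>0$, i.e. the Poisson node intensity is the same constant $\lambda$ on all cells, and let $\tau\in[0,r]$. Then the variance of the $k$-hop path count $\sigma_k(kr-\tau)$ is given by $$\mathrm{Var}_\lambda[\sigma_k(kr-\tau)]=\frac{1}{(k-1)!}\sum_{l=0}^{k-2}\binom{k-1}{l}(\lambda\tau)^{k-1+l}\,\frac{\Gamma((k-1-l)/2+1)}{\Gamma((k-1+l)/2+1)},$$ where $\Gamma(z):=\int_0^\infty x^{z-1}e^{-x}dx$, $z>0$, is the gamma function.
   Context: Fix $r>0$. Nodes form a Poisson point process on $[0,kr]$ with constant intensity $\lambda$ (density $\lambda_i=\lambda$ on the $i$-th cell $((i-1)r,ir]$). Additional nodes are placed at $0$ and at $t\in[0,kr]$; two nodes are connected if and only if their distance is at most $r$. $\sigma_k(t)$ is the number of $k$-hops from $0$ to $t$, i.e. the number of $(k-1)$-tuples of Poisson nodes $0<x_1<\cdots<x_{k-1}<t$ with $x_{i+1}-x_i\le r$ for $i=0,\ldots,k-1$, where $x_0:=0$, $x_k:=t$. *)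

(* Defs.v *)
From HB Require Import structures.
From mathcomp Require Import all_boot all_order all_algebra finmap.
From mathcomp Require Import all_classical all_reals all_analysis.

Set Implicit Arguments.
Unset Strict Implicit.
Unset Printing Implicit Defensive.

Import Order.TTheory GRing.Theory Num.Theory.
Import numFieldNormedType.Exports.

Local Open Scope classical_set_scope.
Local Open Scope ring_scope.

Definition Gamma {R : realType} (z : R) : R :=
  \int[lebesgue_measure]_(x in `]0, +oo[) (x `^ (z - 1) * expR (- x)).

(* A point configuration is a set of reals. All configurations below are
   finite, so [fset_set] does not fall back to its default value. *)
Definition npoints {R : realType} (X : set R) (A : set R) : nat :=
  #|` fset_set (X `&` A) |%fset.

(* Every subset of nat is measurable, so B ranges over all families. *)
Definition mutually_independent {d : measure_display} {T : measurableType d}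
    {R : realType} (P : probability T R) (n : nat) (N : 'I_n -> T -> nat) : Prop :=
  forall B : 'I_n -> set nat,
    P (\bigcap_i (N i @^-1` B i)) = (\prod_(i < n) P (N i @^-1` B i))%E.

(* The process is simple almost surely because its intensity is diffuse, so
   it is realised as a random finite set. [poisson_prob] has a second argument
   which does not occur in its body; we put 0 there. Its value at rate 0 is
   the Dirac mass at 0, as it should be for null sets A. *)
Record poisson_process {d : measure_display} {T : measurableType d}
    {R : realType} (P : probability T R) (D : set R) (lambda : R)
    (X : T -> set R) : Prop := PoissonProcess {
  poisson_finite : forall w, finite_set (X w) ;
  poisson_support : forall w, X w `<=` D ;
  poisson_measurable : forall A : set R, measurable A -> A `<=` D ->
    measurable_fun setT (fun w => npoints (X w) A) ;
  poisson_law : forall A : set R, measurable A -> A `<=` D ->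
    forall B : set nat,
      pushforward P (fun w => npoints (X w) A) B =
      poisson_prob (lambda * fine (lebesgue_measure A)) 0 B ;
  poisson_independent : forall (n : nat) (A : 'I_n -> set R),
    (forall i, measurable (A i)) -> (forall i, A i `<=` D) ->
    trivIset setT A ->
    mutually_independent P (fun i w => npoints (X w) (A i))
}.

(* s = (x_1, ..., x_{k-1}); [path] reads it with x_0 = 0 and x_k = t. *)
Definition khops {R : realType} (r : R) (k : nat) (X : set R) (t : R) :
    set (k.-1.-tuple R) :=
  [set s : k.-1.-tuple R |
    (forall x, x \in (s : seq R) -> X x) /\
    path (fun x y => (x < y) && (y - x <= r)) 0 (rcons s t)].

Arguments khops {R} r k X t.

Definition khop_count {R : realType} (r : R) (k : nat) (X : set R) (t : R) : nat :=
  #|` fset_set (khops r k X t) |%fset.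

(* Main.v *)
(* Put n = k - 1. The i-th point of a k-hop to k r - tau is x_i = i r - u_i, and
   the constraints say, off a null event, that 0 < u_1 < ... < u_n < tau. Cut each
   window into N = 2^m cells in the coordinate u and count the tuples of occupied
   cells, one per window, with strictly increasing column. These counts increase
   with m and reach the path count almost surely. Distinct cells are occupied
   independently with probability p = 1 - exp (- lambda tau / N), so the second
   moment obeys a linear recursion over the columns whose solution is
   sum_q C(N, q) p^q w_q(p), where w_q counts weighted lattice paths from (0, 0)
   to (n, n) with q steps. Letting N -> oo gives sum_q (lambda tau)^q / q! w_q(0),
   and w_{n+l}(0), the coefficient of z^l in (1 - 4 z)^(-(n - l + 1) / 2), comes
   from Chu-Vandermonde. The term l = n is the squared mean. *)

Require Import Defs.
From mathcomp Require Import all_boot all_order all_algebra finmap.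
From mathcomp Require Import all_classical all_reals all_analysis.
From mathcomp Require Import measurable_realfun zify ring lra.

Set Implicit Arguments.
Unset Strict Implicit.
Unset Printing Implicit Defensive.

Import Order.TTheory GRing.Theory Num.Theory.
Import numFieldNormedType.Exports.
Local Open Scope classical_set_scope.
Local Open Scope ring_scope.

(** * Lattice paths *)

Section chain_pairs.
Context {R : realType}.
Implicit Types (p : R) (phi : nat -> nat -> R).

(* A path to [(a, b)] records how two chains of lengths [a] and [b] interleave.
   A diagonal step along the main diagonal is a cell shared by both chains; any
   other diagonal step uses two cells of the same column in different windows
   and costs one more factor [p]. *)
Definition path_step p phi (a b : nat) : R :=
  match a, b with
  | 0, 0 => 0
  | a'.+1, 0 => phi a' 0%N
  | 0, b'.+1 => phi 0%N b'
  | a'.+1, b'.+1 =>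
      phi a' b + phi a b' + (if a' == b' then 1 else p) * phi a' b'
  end.

Definition origin (a b : nat) : R := ((a == 0%N) && (b == 0%N))%:R.

Definition path_weight p (q : nat) := iter q (path_step p) origin.
Arguments path_weight : simpl never.

(** Mixed moment of the numbers of chains of lengths [a] and [b] in the first [M] columns. Each
    iteration adds a column, so this is the operator power (1 + p L)^M with L = [path_step p],
    applied to [origin]. *)
Definition pair_moment p (M : nat) :=
  iter M (fun phi a b => phi a b + p * path_step p phi a b) origin.

Lemma pair_momentS p M a b :
  pair_moment p M.+1 a b = pair_moment p M a b + p * path_step p (pair_moment p M) a b.
Proof. by []. Qed.

Lemma path_weightS p q a b :
  path_weight p q.+1 a b = path_step p (path_weight p q) a b.
Proof. by []. Qed.

(** Binomial expansion of that operator power. Every step raises [a + b], so no path of more than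
    [a + b] steps ends at (a, b), and the sum may stop at any [K] above [a + b]. *)
Lemma pair_moment_sum p M K a b : (a + b < K)%N ->
  pair_moment p M a b =
  \sum_(q < K) 'C(M, q)%:R * p ^+ q * path_weight p q a b.
Proof.
elim: M K a b => [|M IH] K a b abK.
  case: K abK => // K _; rewrite big_ord_recl big1 ?addr0 ?mul1r ?mulr1//.
  by move=> i _; rewrite /bump/= mul0r mul0r.
rewrite pair_momentS (IH K)//; case: K abK => // K abK.
have -> : path_step p (pair_moment p M) a b =
    \sum_(q < K) 'C(M, q)%:R * p ^+ q * path_weight p q.+1 a b.
  case: a b abK => [|a] [|b] abK /=.
  - by rewrite big1 // => i _; rewrite mulr0.
  - by rewrite (IH K) //; lia.
  - by rewrite (IH K) //; lia.
  - rewrite !(IH K); try lia.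
    rewrite mulr_sumr -!big_split /=; apply: eq_bigr => i _.
    rewrite path_weightS/=; ring.
rewrite !big_ord_recl /= !bin0 -addrA; congr (_ + _).
rewrite mulr_sumr -big_split /=; apply: eq_bigr => i _.
rewrite /bump /= !add1n binS natrD exprS; ring.
Qed.

(** A rising factorial with step 2. Divided by l! it is the coefficient of z^l in (1 - 2 z)^(-c /
    2). *)
Definition ascending (c : R) (l : nat) : R := \prod_(i < l) (c + (i.*2)%:R).

Lemma ascendingS c l : ascending c l.+1 = ascending c l * (c + (l.*2)%:R).
Proof. by rewrite /ascending big_ord_recr. Qed.

(** Chu-Vandermonde: multiplying two such series adds the exponents. The induction uses Pascal's
    rule; the two extra factors add up to (c + 2 i) + (e + 2 (l - i)) = c + e + 2 l. *)
Lemma ascending_vandermonde c e l :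
  \sum_(i < l.+1) 'C(l, i)%:R * ascending c i * ascending e (l - i) =
  ascending (c + e) l.
Proof.
elim: l => [|l IH].
  by rewrite big_ord_recl big_ord0 /ascending !big_ord0 bin0 !mulr1 addr0.
rewrite ascendingS -IH mulr_suml.
rewrite big_ord_recl /= bin0 mul1r.
under eq_bigr => i _ do rewrite /bump /= add1n binS natrD subSS !mulrDl.
rewrite big_split /= addrA.
rewrite [in X in _ + X + _]big_ord_recr /= bin_small// !mul0r addr0.
have -> : ascending c 0 * ascending e (l.+1 - 0) +
    \sum_(i < l) 'C(l, i.+1)%:R * ascending c i.+1 * ascending e (l - i) =
    \sum_(i < l.+1) 'C(l, i)%:R * ascending c i * ascending e (l - i).+1.
  rewrite big_ord_recl /= bin0 mul1r; congr (_ * _ + _).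
    by rewrite !subn0.
  apply: eq_bigr => i _; rewrite /bump /= add1n; congr (_ * ascending e _).
  by have := ltn_ord i; lia.
rewrite -big_split /=; apply: eq_bigr => i _.
rewrite !ascendingS -!muln2 !natrM natrB; last by have := ltn_ord i; lia.
ring.
Qed.

(** Coefficient of z^(i - m) in (1 - 4 z)^(-(m + 1) / 2). *)
Definition diagonal_weight (m i : nat) : R :=
  if (m <= i)%N then 2 ^+ (i - m) * ascending m.+1%:R (i - m) / (i - m)`!%:R
  else 0.

(** After clearing factorials this is (2 l)! = 2^l l! times the product of the odd numbers below 2
    l. *)
Lemma central_binomial l : 'C(l + l, l)%:R = diagonal_weight 0 l.
Proof.
rewrite /diagonal_weight subn0 /=.
have lf : l`!%:R != 0 :> R by rewrite pnatr_eq0 -lt0n fact_gt0.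
apply: (mulIf lf); rewrite mulfVK//; apply: (mulIf lf).
rewrite -!natrM.
have -> : ('C(l + l, l) * l`! * l`! = (l + l)`!)%N.
  by rewrite -mulnA -[in RHS](@bin_fact (l + l) l) ?leq_addr// addnK.
elim: l {lf} => [|l IH]; first by rewrite /ascending big_ord0 !mulr1.
rewrite addSn addnS !factS !natrM IH ascendingS exprS -addnn !natrD.
rewrite -(natr1 l) -(natr1 (l + l).+1) -(natr1 (l + l)) natrD; ring.
Qed.

(* Lattice paths from the origin to [(a, b)] with unit steps east and north
   and [m] diagonal steps taken along the main diagonal; the last diagonal step
   starts at [(i, i)]. *)
Definition path_number (m a b : nat) : R :=
  if m is m'.+1 then
    \sum_(i < minn a b) diagonal_weight m' i *
      'C(a.-1 - i + (b.-1 - i), a.-1 - i)%:R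
  else 'C(a + b, a)%:R.

(** Cutting a path at its last diagonal step convolves the coefficients of (1 - 4 z)^(-(m + 1) / 2)
    with central binomials, the coefficients of (1 - 4 z)^(-1 / 2); Chu-Vandermonde adds the
    exponents. *)
Lemma path_number_diag m i : path_number m i i = diagonal_weight m i.
Proof.
case: m => [|m]; first by rewrite /= central_binomial.
rewrite /= minnn /diagonal_weight; case: ltnP => [mi|im]; last first.
  rewrite big1 // => j _; rewrite ifF ?mul0r//.
  by have := ltn_ord j; lia.
(* [diagonal_weight m] vanishes below [m], so only the indices m, ..., m + l contribute, with l = i
   - (m + 1). *)
have -> : i = (m + (i - m.+1).+1)%N by lia.
move: (i - m.+1)%N => l {i mi}.
rewrite big_split_ord /= big1 ?add0r; last first.
  by move=> j _; rewrite ifF ?mul0r//; have := ltn_ord j; lia.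
have -> : (m + l.+1 - m.+1 = l)%N by lia.
have lf k : k`!%:R != 0 :> R by rewrite pnatr_eq0 -lt0n fact_gt0.
apply: (mulIf (lf l)); rewrite mulfVK//.
have <- : m.+1%:R + 1 = m.+2%:R :> R by rewrite natr1.
rewrite -ascending_vandermonde mulr_suml mulr_sumr.
apply: eq_bigr => j _; have jl := ltn_ord j.
rewrite leq_addr addKn addnS /=.
have -> : (m + l - (m + j) = l - j)%N by lia.
rewrite central_binomial /diagonal_weight subn0 /= -(bin_fact (m := j) (n := l)) ?natrM; last lia.
have -> : 2 ^+ l = 2 ^+ j * 2 ^+ (l - j) :> R by rewrite -exprD subnKC; last lia.
by field; rewrite !lf.
Qed.

(** Case split on the final step. It can be diagonal only on the main diagonal, and it is then the
    last diagonal step; the other terms obey Pascal's rule. *)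
Lemma path_numberS m a b :
  path_number m a.+1 b.+1 = path_number m a b.+1 + path_number m a.+1 b +
   (if m is m'.+1 then if a == b then diagonal_weight m' a else 0 else 0).
Proof.
case: m => [|m] /=.
  by rewrite addr0 !addSn !addnS binS natrD addrC.
rewrite minnSS.
wlog ab : a b / (a <= b)%N.
  move=> H; case/orP: (leq_total a b) => [|ba]; first exact: H.
  have := H b a ba; rewrite minnC (minnC b a.+1) (minnC b.+1) (eq_sym b a).
  have E x y i : ('C(x - i + (y - i), x - i) = 'C(y - i + (x - i), y - i))%N.
    rewrite [LHS](_ : _ = 'C(x - i + (y - i), (x - i + (y - i)) - (x - i))%N).
      by rewrite addnC addnK.
    by rewrite bin_sub//; lia.
  under eq_bigr do rewrite E; move=> ->.
  rewrite [X in X + _ = _]addrC; congr (_ + _ + _).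
  - by apply: eq_bigr => i _; rewrite E.
  - by apply: eq_bigr => i _; rewrite E.
  - by case: eqP => [->|].
rewrite (minn_idPl ab) (minn_idPl (leqW ab)).
(* For a = b the summand i = a on the left is the new diagonal step. For a < b it has binomial
   coefficient 1 and matches the top summand of [path_number] at (a + 1, b). *)
have [->|neq] := eqVneq a b.
  rewrite (minn_idPr (leqnSn b)) big_ord_recr /= subnn bin0 mulr1.
  congr (_ + _); rewrite -big_split /=; apply: eq_bigr => i _.
  have ib := ltn_ord i; rewrite -mulrDr; congr (_ * _).
  have -> : (b - i = (b.-1 - i).+1)%N by lia.
  by rewrite !addSn !addnS binS natrD addrC.
have -> : minn a.+1 b = a.+1 by apply/minn_idPl; lia.
rewrite addr0 big_ord_recr /= [in RHS]big_ord_recr /= addrA !subnn !bin0.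
congr (_ + _); rewrite -big_split /=; apply: eq_bigr => i _.
have ib := ltn_ord i; rewrite -mulrDr; congr (_ * _).
have -> : (b - i = (b.-1 - i).+1)%N by lia.
have -> : (a - i = (a.-1 - i).+1)%N by lia.
by rewrite !addSn !addnS binS natrD addrC.
Qed.

(** At p = 0 the only diagonal steps that survive lie on the main diagonal. A diagonal step advances
    a + b by 2 and a unit step by 1, so q steps to (a, b) include a + b - q diagonal ones. *)
Lemma path_weight0 q a b : path_weight 0 q a b =
  if (q <= a + b)%N then path_number (a + b - q) a b else 0.
Proof.
elim: q a b => [|q IH] a b.
  rewrite /path_weight /= /origin subn0.
  case: a b => [|a] [|b] //=.
  - by rewrite min0n big_ord0.
  - by rewrite addn0 /= minn0 big_ord0.
  - rewrite minnSS big1 // => i _; rewrite /diagonal_weight ifF ?mul0r//.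
    by have := ltn_ord i; lia.
rewrite path_weightS; case: a b => [|a] [|b] //=.
- rewrite !IH !add0n ltnS subSS; case: leqP => // qb.
  by case: (b - q)%N => [|m] /=; rewrite ?min0n ?big_ord0 ?bin0.
- rewrite !IH !addn0 ltnS subSS; case: leqP => // qb.
  by case: (a - q)%N => [|m] /=; rewrite ?minn0 ?big_ord0 ?addn0 ?binn.
- rewrite !IH !addSn !addnS !ltnS subSS.
  case: leqP => [qab|]; last first.
    by move=> qab; rewrite [X in _ * X]ifF ?mulr0 ?addr0//; lia.
  rewrite path_numberS; congr (_ + _).
  have [->|nab] := eqVneq a b; last by rewrite mul0r; case: (_ - _)%N.
  rewrite mul1r; case: leqP => [qb|bq].
    by rewrite subSn //= path_number_diag.
  by have -> : ((b + b).+1 - q = 0)%N by lia.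
Qed.

Lemma path_weight0_diag n l : (l <= n)%N ->
  path_weight 0 (n + l) n n = 2 ^+ l * ascending (n - l).+1%:R l / l`!%:R.
Proof.
move=> ln; rewrite path_weight0 leq_add2l ln subnDl path_number_diag.
by rewrite /diagonal_weight leq_subr subKn.
Qed.

Lemma path_weight0_side q n : path_weight 0 q n 0 = (q == n)%:R.
Proof.
by elim: q n => [|q IH] [|n] //; rewrite path_weightS /= IH.
Qed.

Lemma path_weight0_small q n : (q < n)%N -> path_weight 0 q n n = 0.
Proof.
move=> qn; rewrite path_weight0 ifT; last lia.
by rewrite path_number_diag /diagonal_weight ifF//; lia.
Qed.

End chain_pairs.

(** * Poisson limit of the pair moments *)

Section moment_limit.
Context {R : realType}.

Lemma cvg_path_weight (p : R^nat) q a b : p @ \oo --> (0 : R) ->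
  path_weight (p m) q a b @[m --> \oo] --> path_weight 0 q a b.
Proof.
move=> p0; elim: q a b => [|q IH] a b; first exact: cvg_cst.
rewrite path_weightS; under eq_fun do rewrite path_weightS.
case: a b => [|a] [|b] /=; [exact: cvg_cst|exact: IH|exact: IH|].
apply: cvgD; first by apply: cvgD; exact: IH.
by apply: cvgM; [case: eqP => _; [exact: cvg_cst|]|exact: IH].
Qed.

(** Induction on q through the ratio (N p - q p) / (q + 1) of consecutive terms. *)
Lemma cvg_binomial_pow (p : R^nat) (N : nat -> nat) (x : R) q :
  p @ \oo --> (0 : R) -> (N m)%:R * p m @[m --> \oo] --> x ->
  'C(N m, q)%:R * p m ^+ q @[m --> \oo] --> x ^+ q / q`!%:R.
Proof.
move=> p0 Npx; elim: q => [|q IH].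
  under eq_fun do rewrite bin0 mulr1; rewrite fact0 divr1; exact: cvg_cst.
have E m : 'C(N m, q.+1)%:R * p m ^+ q.+1 =
    q.+1%:R^-1 * ('C(N m, q)%:R * p m ^+ q * ((N m)%:R * p m - q%:R * p m)).
  apply: (@mulfI _ q.+1%:R); first by rewrite pnatr_eq0.
  rewrite mulVKf ?pnatr_eq0// mulrA -natrM mul_bin_left natrM exprS.
  (* The subtraction N - q is truncated; when N < q, the factor 'C(N, q) is 0 and both sides
     vanish. *)
  have [qN|Nq] := leqP q (N m); first by rewrite natrB//; ring.
  by rewrite bin_small// !(mulr0, mul0r).
under eq_fun do rewrite E.
have -> : x ^+ q.+1 / q.+1`!%:R = q.+1%:R^-1 * (x ^+ q / q`!%:R * (x - q%:R * 0)).
  rewrite mulr0 subr0 factS natrM invfM exprS; ring.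
apply: cvgM; first exact: cvg_cst.
apply: cvgM => //; apply: cvgB => //; apply: cvgM => //; exact: cvg_cst.
Qed.

Lemma cvg_pair_moment (p : R^nat) (N : nat -> nat) (x : R) a b :
  p @ \oo --> (0 : R) -> (N m)%:R * p m @[m --> \oo] --> x ->
  pair_moment (p m) (N m) a b @[m --> \oo] -->
  \sum_(q < (a + b).+1) x ^+ q / q`!%:R * path_weight 0 q a b.
Proof.
move=> p0 Npx; under eq_fun do rewrite (@pair_moment_sum _ _ _ (a + b).+1)//.
apply: cvg_big => [|q _]; first exact: add_continuous.
  apply: cvgM; first exact: cvg_binomial_pow.
exact: cvg_path_weight.
Qed.

End moment_limit.

(** * The gamma function *)

Section gamma_function.
Context {R : realType}.
Local Notation mu := (@lebesgue_measure R).
Implicit Types x y z : R.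

Let gammaf y (x : R) : R := x `^ y * expR (- x).

(** Exponential domination gives both integrability on the half line and decay at infinity. *)
Let gammaf_bound y : 0 < y ->
  exists2 C : R, 0 <= C & forall x, 0 <= x -> gammaf y x <= C * expR (- (2^-1 * x)).
Proof.
(* The constant is the maximum of x^y exp(-x / 2), reached at x = 2 y; the bound is the tangent
   inequality for ln at 2 y. *)
move=> y0; exists (expR (y * ln (2 * y) - y)); first exact: expR_ge0.
move=> x; rewrite le_eqVlt => /predU1P[<-|x0].
  by rewrite /gammaf powR0 ?gt_eqF// mul0r mulr_ge0 ?expR_ge0.
rewrite /gammaf /powR gt_eqF// -!expRD ler_expR.
have y2 : 0 < 2 * y by rewrite mulr_gt0.
have xy : 0 < x / (2 * y) by rewrite divr_gt0.
have lnx : ln x <= x / (2 * y) - 1 + ln (2 * y).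
  have -> : ln x = ln (x / (2 * y)) + ln (2 * y).
    by rewrite -lnM ?posrE// divfK// gt_eqF.
  rewrite lerD2r.
  have /le_ln1Dx : -1 < x / (2 * y) - 1 by rewrite ltrBrDl subrr.
  by rewrite addrC subrK.
have -> : - (2^-1 * x) = y * (x / (2 * y)) - x by field; rewrite gt_eqF.
have := ler_wpM2l (ltW y0) lnx; lra.
Qed.

Let gammaf_ge0 y x : 0 <= gammaf y x.
Proof. by rewrite mulr_ge0 ?powR_ge0 ?expR_ge0. Qed.

Let measurable_gammaf y (D : set R) : measurable D -> measurable_fun D (gammaf y).
Proof.
move=> mD; apply: measurable_funTS; apply: measurable_funM.
  exact: measurable_powR.
exact: measurableT_comp.
Qed.

Let integrable_gammaf y : 0 < y -> mu.-integrable `[0, +oo[ (EFin \o gammaf y).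
Proof.
move=> y0; have [C C0 CP] := gammaf_bound y0.
(* The factor 2 cancels the rate 1/2 in the exponential density. *)
have e : mu.-integrable `[0, +oo[ (fun x => (C * 2)%:E * (exponential_pdf 2^-1 x)%:E)%E.
  apply: integrableZl => //.
  by apply: integrableS (@integrable_exponential_pdf R 2^-1 _).
apply: le_integrable e => //.
  by apply/measurable_EFinP; exact: measurable_gammaf.
move=> x /=; rewrite in_itv/= andbT => x0.
rewrite lee_fin ger0_norm// exponential_pdfE //.
rewrite ger0_norm; last by rewrite !mulr_ge0 ?expR_ge0.
by rewrite -mulrA mulVKf// mulNr; exact: CP.
Qed.

Let cvgy_gammaf y : 0 < y -> gammaf y x @[x --> +oo] --> (0 : R).
Proof.
move=> y0; have [C C0 CP] := gammaf_bound y0.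
apply: (@squeeze_cvgr _ _ _ _ (cst 0) (fun x => C * expR (- (2^-1 * x)))).
- near=> x; rewrite /= gammaf_ge0 CP//; near: x; exact: nbhs_pinfty_ge.
- exact: cvg_cst.
- rewrite -[X in _ --> X](mulr0 C); apply: cvgM; first exact: cvg_cst.
  apply: (@cvg_comp _ _ _ (fun x : R => 2^-1 * x) (fun x => expR (- x)) _ +oo).
    by apply: gt0_cvgMry.
  exact: cvgr_expR.
Unshelve. all: by end_near. Qed.

Let is_derive_gammaf y (x : R) : 0 < x ->
  is_derive (x : R) (1 : R) (gammaf y) (y * gammaf (y - 1) x - gammaf y x).
Proof.
move=> x0; have dp := is_derive1_powR y x0.
apply: is_derive_eq; rewrite /gammaf /GRing.scale/=; ring.
Qed.

Let continuous_gammaf y x : 0 < x -> {for x, continuous (gammaf y)}.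
Proof.
move=> x0; apply/differentiable_continuous/derivable1_diffP.
by have [] := is_derive_gammaf y x0.
Qed.

Let cvg_gammaf0 y : 0 < y -> gammaf y x @[x --> 0^'+] --> gammaf y 0.
Proof.
move=> y0; rewrite {2}/gammaf powR0 ?gt_eqF// mul0r -[X in _ --> X](mul0r (expR (- 0))).
apply: cvgM; first exact: powR_cvg0.
apply: cvg_at_right_filter; apply: continuous_comp; first exact: continuousN.
exact: continuous_expR.
Qed.

Let within_gammaf y : 0 < y -> {within `[0, +oo[, continuous (gammaf y)}.
Proof.
move=> y0; apply/continuous_within_itvcyP; split; last exact: cvg_gammaf0.
by move=> x; rewrite in_itv/= andbT; exact: continuous_gammaf.
Qed.

(** Integration by parts: the difference of the integrands is the derivative of -x^z exp(-x), which
    vanishes at 0 and at infinity. With 1 < z the exponent z - 1 is positive, so [gammaf (z - 1)] is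
    continuous up to 0. *)
Lemma GammaD1 z : 1 < z -> Gamma (z + 1) = z * Gamma z.
Proof.
move=> z1; have z0 : 0 < z := lt_trans ltr01 z1.
have z10 : 0 < z - 1 by rewrite subr_gt0.
have oy : `]0 : R, +oo[ `<=` `[0, +oo[.
  by apply: subset_itv; rewrite bnd_simp.
have ig0 := integrable_gammaf z0.
have iz0 : mu.-integrable `[0, +oo[ (EFin \o (fun x => z * gammaf (z - 1) x)).
  by have := integrable_gammaf z10; move/(integrableZl _ z); apply.
have restrict g : mu.-integrable `[0, +oo[ (EFin \o g) ->
    mu.-integrable `]0, +oo[ (EFin \o g) by exact: integrableS.
rewrite /Gamma addrK; apply/subr0_eq.
rewrite -RintegralZl//; last by apply: restrict; exact: integrable_gammaf.
rewrite -RintegralB//; [|exact: restrict|exact: restrict].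
pose f x := gammaf z x - z * gammaf (z - 1) x.
have cf : {within `[0, +oo[, continuous f}.
  move=> x; apply: cvgB; first exact: within_gammaf.
  by apply: cvgM; [exact: cvg_cst|exact: within_gammaf].
have integrable_f : mu.-integrable `[0, +oo[ (EFin \o f).
  by have := integrableB _ ig0 iz0; apply.
have dF x : 0 < x -> is_derive (x : R) (1 : R) (- gammaf z) (f x).
  move=> x0; have d := is_derive_gammaf z x0.
  by apply: is_derive_eq; rewrite /f opprB.
have dF1 x : 0 < x -> (- gammaf z)^`()%classic x = f x.
  by move=> x0; rewrite derive1E; have [_ ->] := dF _ x0.
have cF x : 0 < x -> {for x, continuous (- gammaf z)}.
  by move=> x0; apply: continuousN; exact: continuous_gammaf.
have -> : \int[mu]_(x in `]0, +oo[) f x = \int[mu]_(x in `[0, +oo[) f x.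
  by apply: Rintegral_itv_obnd_cbnd; exact: restrict.
(* Since f x = x^(z - 1) (x - z) exp(-x), the integrand is nonnegative from z on, as the half-line
   fundamental theorem asks. The compact part [0, z] is treated apart, and the two values at z
   cancel. *)
have tail : \int[mu]_(x in `[z, +oo[) f x = gammaf z z.
  rewrite (@Rintegral_ge0_continuous_FTC2y _ f (- gammaf z) z 0).
  - by rewrite opprK add0r.
  - move=> x zx; have x0 := lt_le_trans z0 zx.
    rewrite /f /gammaf -(mulr_powRB1 (ltW x0) z0) -!mulrA -mulrBl.
    by rewrite mulr_ge0 ?subr_ge0// mulr_ge0 ?powR_ge0 ?expR_ge0.
  - by apply: continuous_subspaceW cf; apply: subset_itv; rewrite bnd_simp ?ltW.
  - by rewrite -oppr0; apply: cvgN; exact: cvgy_gammaf.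
  - by move=> x zx; have [] := dF _ (lt_trans z0 zx).
  - by apply: cvg_at_right_filter; exact: cF.
  - by move=> x; rewrite in_itv/= andbT => /(lt_trans z0); exact: dF1.
have head : \int[mu]_(x in `[0, z]) f x = - gammaf z z.
  rewrite /Rintegral (@continuous_FTC2 _ f (- gammaf z))//.
  - have g0 : gammaf z 0 = 0 by rewrite /gammaf powR0 ?gt_eqF// mul0r.
    by rewrite -EFinB/= /GRing.opp/= g0 -[LHS]/(- gammaf z z - - 0) oppr0 subr0.
  - by apply: continuous_subspaceW cf; apply: subset_itv; rewrite bnd_simp.
  - split.
    + by move=> x; rewrite in_itv/= => /andP[x0 _]; have [] := dF _ x0.
    + by apply: cvgN; exact: cvg_gammaf0.
    + by apply: cvg_at_left_filter; exact: cF.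
  - by move=> x; rewrite in_itv/= => /andP[x0 _]; exact: dF1.
have := Rintegral_itvB integrable_f (x := z).
rewrite !bnd_simp (ltW z0) head => /(_ isT isT).
have -> : \int[mu]_(x in `]z, +oo[) f x = \int[mu]_(x in `[z, +oo[) f x.
  apply: Rintegral_itv_obnd_cbnd; apply: integrableS integrable_f => //.
  by apply: subset_itv; rewrite bnd_simp ?ltW.
by rewrite tail opprK => /(canRL (addrK _)); rewrite subrr.
Qed.

(** Comparison with the constant exp(-2) on [1, 2], where x^(z - 1) >= 1. *)
Lemma Gamma_gt0 z : 1 < z -> 0 < Gamma z.
Proof.
rewrite -subr_gt0 => z1.
have ig := integrable_gammaf z1.
have igo : mu.-integrable `]0, +oo[ (EFin \o gammaf (z - 1)).
  by apply: integrableS ig => //; apply: subset_itv; rewrite bnd_simp.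
rewrite -lte_fin /Gamma /Rintegral fineK; last exact: integrable_fin_num igo.
have gt0 : (0 < \int[mu]_(x in `[1%R, 2%R]) (expR (- 2))%:E)%E.
  rewrite integral_cst//= lebesgue_measure_itv/= lte_fin ltr1n.
  by rewrite -EFinD -EFinM lte_fin mulr_gt0 ?expR_gt0//; lra.
apply: (lt_le_trans gt0).
have le_gammaf : (\int[mu]_(x in `[1%R, 2%R]) (expR (- 2))%:E <=
    \int[mu]_(x in `[1%R, 2%R]) (gammaf (z - 1) x)%:E)%E.
  apply: ge0_le_integral => //.
  - by apply/measurable_EFinP; exact: measurable_gammaf.
  - move=> x; rewrite /= in_itv/= lee_fin => /andP[x1 x2].
    rewrite /gammaf -[leLHS]mul1r ler_pM ?expR_ge0 ?ler_expR ?lerN2//.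
    have {1}-> : 1 = 1 `^ (z - 1) :> R by rewrite powR1.
    by rewrite ge0_ler_powR ?nnegrE ?(ltW z1)// (le_trans _ x1).
apply: (le_trans le_gammaf); apply: ge0_subset_integral => //.
- by apply/measurable_EFinP; exact: measurable_gammaf.
- by move=> x _; rewrite lee_fin gammaf_ge0.
- by apply: subset_itv; rewrite bnd_simp.
Qed.

End gamma_function.

(** * Closed form of the limiting variance *)

Section variance_sum.
Context {R : realType}.
Implicit Type x : R.

(** The factors m + 1, m + 3, ... and m + 2, m + 4, ... interleave. *)
Lemma ascending_mul_fact m l :
  ascending m.+1%:R l * ascending m.+2%:R l * m`!%:R = (m + l.*2)`!%:R :> R.
Proof.
elim: l => [|l IH]; first by rewrite /ascending !big_ord0 !mul1r addn0.
rewrite doubleS !addnS !factS !natrM -IH !ascendingS.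
rewrite -!(natr1 m.+1) -!(natr1 m) -!natr1 natrD; ring.
Qed.

(** Raising l by one raises the argument by one, so [GammaD1] applies l times; m > 0 gives its bound
    1 < z. *)
Lemma GammaD_half m l : (0 < m)%N ->
  Gamma ((m + l.*2)%:R / 2 + 1) = Gamma (m%:R / 2 + 1) * ascending m.+2%:R l / 2 ^+ l :> R.
Proof.
move=> m0; elim: l => [|l IH].
  by rewrite /ascending big_ord0 addn0 mulr1 divr1.
have -> : (m + l.+1.*2)%:R / 2 + 1 = ((m + l.*2)%:R / 2 + 1) + 1 :> R.
  by rewrite doubleS !addnS -!natr1; field.
rewrite GammaD1; last by rewrite ltrDr divr_gt0// ltr0n addn_gt0 m0.
rewrite IH ascendingS exprS natrD -!(natr1 m.+1) -(natr1 m).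
by field; rewrite expf_neq0.
Qed.

(** Put m = n - l, positive as [GammaD_half] requires. The weight is 2^l / l! times
    [ascending m.+1%:R l], the Gamma quotient is 2^l over [ascending m.+2%:R l], and (n + l)! = (m +
    2 l)! is the product of both ascending factors and m!. *)
Lemma second_moment_term n l x : (l < n)%N ->
  x ^+ (n + l) / (n + l)`!%:R * path_weight 0 (n + l) n n =
  n`!%:R^-1 * ('C(n, l)%:R * x ^+ (n + l) *
    (Gamma ((n - l)%:R / 2 + 1) / Gamma ((n + l)%:R / 2 + 1))).
Proof.
move=> ln; rewrite path_weight0_diag ?(ltnW ln)//.
have lf k : k`!%:R != 0 :> R by rewrite pnatr_eq0 -lt0n fact_gt0.
have mpos : (0 < n - l)%N by rewrite subn_gt0.
have := bin_fact (ltnW ln).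
have {ln} -> : n = (n - l + l)%N by lia.
move: (n - l)%N mpos => m m0; rewrite addnK -!addnA addnn => binE.
have binE' : 'C(m + l, l)%:R = (m + l)`!%:R / (l`!%:R * m`!%:R) :> R.
  by rewrite -binE !natrM mulfK// mulf_neq0.
rewrite GammaD_half// binE' -ascending_mul_fact.
have G0 : Gamma (m%:R / 2 + 1) != 0 :> R.
  by rewrite gt_eqF// Gamma_gt0// ltrDr divr_gt0// ltr0n.
have A0 k : (0 < k)%N -> ascending k%:R l != 0 :> R.
  move=> k0; apply/prodf_neq0 => i _.
  by rewrite -natrD pnatr_eq0 addn_eq0 negb_and -lt0n k0.
field.
by rewrite !lf G0 !A0// expf_neq0.
Qed.

(** The left side is the limiting second moment minus the squared limiting mean. Terms with q < n
    vanish, q = n + l with l < n gives the l-th term on the right, and q = 2 n cancels the squared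
    mean. *)
Lemma variance_sum n x : (0 < n)%N ->
  \sum_(q < (n + n).+1) x ^+ q / q`!%:R * path_weight 0 q n n -
    (\sum_(q < (n + 0).+1) x ^+ q / q`!%:R * path_weight 0 q n 0) ^+ 2 =
  n`!%:R^-1 * \sum_(0 <= l < n) 'C(n, l)%:R * x ^+ (n + l) *
    (Gamma ((n - l)%:R / 2 + 1) / Gamma ((n + l)%:R / 2 + 1)).
Proof.
move=> n0.
have lf k : k`!%:R != 0 :> R by rewrite pnatr_eq0 -lt0n fact_gt0.
have -> : \sum_(q < (n + 0).+1) x ^+ q / q`!%:R * path_weight 0 q n 0 = x ^+ n / n`!%:R.
  rewrite addn0 big_ord_recr /= path_weight0_side eqxx mulr1 big1 ?add0r// => i _.
  by rewrite path_weight0_side (ltn_eqF (ltn_ord i)) mulr0.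
rewrite -addnS big_split_ord /= big1 ?add0r; last first.
  by move=> i _; rewrite path_weight0_small ?mulr0.
rewrite big_ord_recr /= big_mkord mulr_sumr.
under eq_bigr => l _ do rewrite second_moment_term//.
rewrite -addrA [X in _ + X](_ : _ = 0) ?addr0//.
rewrite path_weight0_diag// subnn expr_div_n -exprM muln2 -addnn.
apply/eqP; rewrite subr_eq0; apply/eqP.
(* Here (2 n)! is [ascending 1 n] times [ascending 2 n], and the latter is 2^n n!, so the top term
   becomes (x^n / n!)^2. *)
have := ascending_mul_fact 0 n; rewrite fact0 mulr1 add0n -addnn => <-.
have -> : ascending 2 n = 2 ^+ n * n`!%:R :> R.
  elim: {n0} n => [|n IH]; first by rewrite /ascending big_ord0 fact0 mulr1.
  rewrite ascendingS IH exprS factS natrM -muln2 -natr1 natrM; ring.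
have A0 : ascending 1 n != 0 :> R.
  apply/prodf_neq0 => i _.
  by rewrite -(natrD _ 1%N) pnatr_eq0.
by field; rewrite lf A0 expf_neq0.
Qed.

End variance_sum.

(** * Limits of variances *)

Section off_null_sets.
Local Open Scope ereal_scope.
Context {d : measure_display} {T : measurableType d} {R : realType}.
Variables (mu : {measure set T -> \bar R}) (N : set T).
Hypotheses (mN : measurable N) (muN : mu N = 0).
Import HBNNSimple.

Let ge0_le_integral_off_null (f g : T -> \bar R) :
  (forall x, 0 <= f x) -> (forall x, 0 <= g x) ->
  (forall x, ~ N x -> f x <= g x) ->
  \int[mu]_x f x <= \int[mu]_x g x.
Proof.
move=> f0 g0 fg; rewrite !ge0_integralTE//.
apply: ge_ereal_sup => _ [h /= hf <-]; apply: ereal_sup_ubound => /=.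
pose h' : {nnsfun T >-> R} := mul_nnsfun h (indic_nnsfun R (measurableC mN)).
have h'E x : h' x = (h x * (x \in ~` N)%:R)%R by [].
exists h'.
  move=> x; rewrite h'E.
  have [xN|xN] := boolP (x \in ~` N); last by rewrite mulr0.
  by rewrite mulr1 (le_trans (hf x))// fg//; move: xN; rewrite inE.
have sE (k : {nnsfun T >-> R}) : sintegral mu k = \int[mu]_x (k x)%:E.
  by rewrite integral_nnsfun// patch_setT.
rewrite !sE; apply: ge0_ae_eq_integral => //.
- exact/measurable_EFinP.
- exact/measurable_EFinP.
- by move=> x _; rewrite lee_fin.
- by move=> x _; rewrite lee_fin.
exists N; split => // x /= xneq; apply: contrapT => Nx; apply: xneq => _.
by rewrite -[LHS]/(h' x)%:E h'E mem_set// mulr1.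
Qed.

Let ge0_eq_integral_off_null (f g : T -> \bar R) :
  (forall x, 0 <= f x) -> (forall x, 0 <= g x) ->
  (forall x, ~ N x -> f x = g x) ->
  \int[mu]_x f x = \int[mu]_x g x.
Proof.
move=> f0 g0 fg; apply/eqP; rewrite eq_le.
by rewrite !ge0_le_integral_off_null// => x /fg ->.
Qed.

(* Stated without measurability so that it applies to [khop_count] directly;
   [ge0_ae_eq_integral] requires both functions to be measurable. *)
Lemma eq_integral_off_null (f g : T -> \bar R) :
  (forall x, ~ N x -> f x = g x) -> \int[mu]_x f x = \int[mu]_x g x.
Proof.
move=> fg; rewrite integralE [RHS]integralE; congr (_ - _).
- by apply: ge0_eq_integral_off_null => // x /fg; rewrite !funepos.unlock => ->.
- by apply: ge0_eq_integral_off_null => // x /fg; rewrite !funeneg.unlock => ->.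
Qed.

End off_null_sets.

Section variance_limit.
Local Open Scope ereal_scope.
Context {d : measure_display} {T : measurableType d} {R : realType}.
Variables (P : probability T R) (N : set T).
Hypotheses (mN : measurable N) (PN : P N = 0).

Lemma variance_off_null (f g : T -> R) : (forall x, ~ N x -> f x = g x) ->
  'V_P[f] = 'V_P[g].
Proof.
move=> fg; rewrite /variance covariance.unlock expectation.unlock.
have -> : \int[P]_w (f w)%:E = \int[P]_w (g w)%:E.
  by apply: (eq_integral_off_null mN PN) => x /fg ->.
apply: (eq_integral_off_null mN PN) => x /fg fgx.
by congr ((_ * _)%:E)%R; rewrite /= fgx.
Qed.

Lemma Lfun2_integrable (f : T -> R) : measurable_fun setT f ->
  \int[P]_w (f w ^+ 2)%:E < +oo -> f \in Lfun P 2%:E.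
Proof.
move=> mf f2; rewrite inE; apply/andP; split; rewrite inE//=.
rewrite /finite_norm Lnorm.unlock/= poweR_lty//.
apply: le_lt_trans f2; apply: ge0_le_integral => //.
- apply/measurable_EFinP.
  apply/(@measurableT_comp _ _ _ _ _ _ (fun x : R => x `^ 2)%R) => //.
  exact/measurableT_comp.
- by apply/measurable_EFinP; exact: measurable_funX.
- by move=> x _; rewrite lee_fin powR_mulrn// real_normK// num_real.
Qed.

(** Monotone convergence for Z and its square. All functions are first set to 0 on [N], so that the
    limit exists everywhere and is measurable, which is not assumed of [S]. *)
Lemma variance_limit (Z : (T -> nat)^nat) (S : T -> nat) (a b : R) :
  (forall m, measurable_fun setT (fun w => (Z m w)%:R : R)) ->
  (forall w, {homo Z ^~ w : m m' / (m <= m')%N}) ->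
  (forall w, ~ N w -> \forall m \near \oo, Z m w = S w) ->
  \int[P]_w (Z m w)%:R%:E @[m --> \oo] --> a%:E ->
  \int[P]_w (Z m w ^ 2)%:R%:E @[m --> \oo] --> b%:E ->
  'V_P[fun w => (S w)%:R : R] = (b - a ^+ 2)%:E.
Proof.
move=> mZ ndZ ZS Za Zb.
pose f m w : R := ((Z m w)%:R * \1_(~` N) w)%R.
pose g w : R := ((S w)%:R * \1_(~` N) w)%R.
have mf m : measurable_fun setT (f m).
  apply: measurable_funM => //.
  by apply: measurable_indic; exact: measurableC.
have offN w : ~ N w -> \1_(~` N) w = 1%R :> R by move=> Nw; rewrite indicE mem_set.
have onN w : N w -> \1_(~` N) w = 0%R :> R by move=> Nw; rewrite indicE memNset.
have fg w : \forall m \near \oo, f m w = g w.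
  have [Nw|Nw] := pselect (N w).
    by near=> m; rewrite /f /g onN// !mulr0.
  by apply: filterS (ZS w Nw) => m; rewrite /f /g => ->.
have mg : measurable_fun setT g.
  apply: (@measurable_fun_cvg _ _ _ _ f) => // w _.
  by apply: cvg_near_cst; exact: fg.
have f0 m w : (0 <= f m w)%R by rewrite mulr_ge0// indicE.
have ndf w m m' : (m <= m')%N -> (f m w <= f m' w)%R.
  by move=> mm'; rewrite ler_wpM2r ?indicE// ler_nat ndZ.
have limit k c : (0 < k)%N -> \int[P]_w (Z m w ^ k)%:R%:E @[m --> \oo] --> c%:E ->
    \int[P]_w (g w ^+ k)%:E = c%:E.
  move=> k0 Zc.
  have E m : \int[P]_w (Z m w ^ k)%:R%:E = \int[P]_w (f m w ^+ k)%:E.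
    apply: (eq_integral_off_null mN PN) => w Nw.
    by rewrite /f offN// mulr1 natrX.
  rewrite (_ : (fun w => (g w ^+ k)%:E) = fun w => limn (fun m => (f m w ^+ k)%:E)); last first.
    apply/funext => w; apply/esym/cvg_lim => //.
    by apply: cvg_near_cst; apply: filterS (fg w) => m ->.
  have := @cvg_monotone_convergence _ _ _ P setT measurableT (fun m w => (f m w ^+ k)%:E).
  have cvgE : \int[P]_w (f m w ^+ k)%:E @[m --> \oo] --> c%:E.
    by under eq_fun do rewrite -E.
  move=> H; apply: (cvg_unique _ (H _ _ _) cvgE) => //.
  - by move=> m; apply/measurable_EFinP; exact: measurable_funX.
  - by move=> m w _; rewrite lee_fin exprn_ge0.
  - by move=> w _ m m' mm'; rewrite lee_fin lerXn2r ?nnegrE// ndf.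
have g2 := limit 2%N b isT Zb.
have g1 := limit 1%N a isT Za.
have -> : 'V_P[fun w => (S w)%:R : R] = 'V_P[g].
  by apply: variance_off_null => w Nw; rewrite /g offN// mulr1.
rewrite varianceE; last by apply: Lfun2_integrable => //; rewrite g2 ltry.
rewrite expectation.unlock EFinB; congr (_ - _).
  by rewrite -g2; apply: eq_integral => w _; rewrite !fctE.
have -> : \int[P]_w (g w)%:E = a%:E by rewrite -g1.
by rewrite expe2 -EFinM expr2.
Unshelve. all: by end_near. Qed.

End variance_limit.

(** * Moments of chains of occupied cells *)

(** Counts choices of one occupied cell in each window 0, ..., a - 1 with strictly increasing
    columns below M. Recursion on the last column suits the use of independence one column at a
    time. *)
Fixpoint chain_count (occ : nat -> nat -> bool) (a M : nat) : nat :=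
  match M, a with
  | _, 0 => 1
  | 0, _.+1 => 0
  | M'.+1, a'.+1 => chain_count occ a M' + occ a' M' * chain_count occ a' M'
  end.
Arguments chain_count : simpl never.

Lemma chain_count0 occ M : chain_count occ 0 M = 1%N.
Proof. by case: M. Qed.

Lemma chain_countS occ a M : chain_count occ a.+1 M.+1 =
  (chain_count occ a.+1 M + occ a M * chain_count occ a M)%N.
Proof. by []. Qed.

(** Column j splits into 2 j and 2 j + 1, and an occupied cell has an occupied half, so every chain
    survives the refinement. *)
Lemma leq_chain_count_double (occ occ' : nat -> nat -> bool) (n N a M : nat) :
  (forall i j, (i < n)%N -> (j < N)%N -> occ i j -> occ' i j.*2 || occ' i j.*2.+1) ->
  (a <= n)%N -> (M <= N)%N ->
  (chain_count occ a M <= chain_count occ' a M.*2)%N.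
Proof.
move=> refine; elim: M a => [|M IH] [|a] an MN //.
rewrite doubleS !chain_countS.
have IHS := IH a.+1 an (ltnW MN); have IHa := IH a (ltnW an) (ltnW MN).
have := refine a M an MN.
(* For the case where only the second half is occupied: the chain before it then ranges over 2 M + 1
   columns. *)
have step : (chain_count occ' a M.*2 <= chain_count occ' a M.*2.+1)%N.
  by case: (a) => [|b]; rewrite ?chain_count0// chain_countS leq_addr.
case: (occ a M) => /= [/(_ isT)|_]; last lia.
case: (occ' a M.*2); case: (occ' a M.*2.+1) => //= _; lia.
Qed.

Section chain_moments.
Local Open Scope ereal_scope.
Context {d : measure_display} {T : measurableType d} {R : realType}.
Variables (P : probability T R) (n N : nat) (occ : T -> nat -> nat -> bool) (p : R).

Definition all_occupied (w : T) (S : seq (nat * nat)) : bool :=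
  all (fun c => occ w c.1 c.2) S.

Hypothesis measurable_occ : forall i j, (i < n)%N -> (j < N)%N ->
  measurable_fun setT (fun w => (occ w i j)%:R : R).
Hypothesis occ_indep : forall S : seq (nat * nat), uniq S ->
  {in S, forall c, (c.1 < n)%N && (c.2 < N)%N} ->
  P [set w | all_occupied w S] = (p ^+ size S)%:E.

Let Z a M w := chain_count (occ w) a M.

Lemma measurable_chain_count a M : (a <= n)%N -> (M <= N)%N ->
  measurable_fun setT (fun w => (Z a M w)%:R : R).
Proof.
elim: M a => [|M IH] [|a] an MN; try exact: measurable_cst.
rewrite /Z; under eq_fun do rewrite chain_countS natrD natrM.
apply: measurable_funD; first exact: IH (ltnW MN).
by apply: measurable_funM; [exact: measurable_occ|exact: IH (ltnW an) (ltnW MN)].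
Qed.

Let measurable_all_occupied S : {in S, forall c, (c.1 < n)%N && (c.2 < N)%N} ->
  measurable_fun setT (fun w => (all_occupied w S)%:R : R).
Proof.
elim: S => [|[i j] S IH] //= inS.
have /andP[ilt jlt] := inS (i, j) (mem_head _ _).
under eq_fun do rewrite -mulnb natrM.
apply: measurable_funM; first exact: measurable_occ.
by apply: IH => c cS; apply: inS; rewrite in_cons cS orbT.
Qed.

Let moment (f : T -> nat) := \int[P]_w (f w)%:R%:E.

Let momentD (f g : T -> nat) : measurable_fun setT (fun w => (f w)%:R : R) ->
  measurable_fun setT (fun w => (g w)%:R : R) ->
  moment (fun w => f w + g w)%N = moment f + moment g.
Proof.
move=> mf mg; rewrite /moment; under eq_integral do rewrite natrD EFinD.
by rewrite ge0_integralD//; apply/measurable_EFinP.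
Qed.

Let joint a b M S w := (Z a M w * Z b M w * all_occupied w S)%N.

(* [S] lists the cells of columns [>= M] that have already been split off, which
   is what lets independence be used one column at a time. *)
Lemma chain_count_joint_moment M a b S : (M <= N)%N -> (a <= n)%N -> (b <= n)%N ->
  uniq S -> {in S, forall c, [&& c.1 < n, M <= c.2 & c.2 < N]%N} ->
  \int[P]_w (joint a b M S w)%:R%:E = (pair_moment p M a b * p ^+ size S)%:E.
Proof.
have inS' (S' : seq (nat * nat)) k : {in S', forall c, [&& c.1 < n, k <= c.2 & c.2 < N]%N} ->
    {in S', forall c, (c.1 < n)%N && (c.2 < N)%N}.
  by move=> H c /H /and3P[-> _ ->].
elim: M a b S => [|M IH] a b S MN an bn uS inS.
  (* With no column left, only a pair of empty chains counts, and the integral is the probability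
     that all of [S] is occupied. *)
  rewrite /joint /Z/=; have [ab0|ab0] := boolP ((a == 0%N) && (b == 0%N)).
    have /andP[/eqP-> /eqP->] := ab0.
    under eq_integral do rewrite mul1n.
    rewrite /pair_moment/= /origin/= mul1r -occ_indep//.
    have mA : measurable [set w | all_occupied w S].
      have := measurable_all_occupied (inS' _ _ inS) measurableT (measurable_set1 1%R).
      rewrite setTI; congr (measurable _); apply/seteqP; split => w /=.
        by move/eqP; rewrite pnatr_eq1 eqb1.
      by move=> ->.
    rewrite -(setIT [set w | _]) -integral_indic//.
    by apply: eq_integral => w _; rewrite indicE mem_setE/=.
  rewrite /pair_moment/= /origin (negbTE ab0) mul0r.
  under eq_integral => w _.
    rewrite (_ : _ * _ = 0)%N; first over.
    by case: a b {an bn} ab0 => [|a] [|b].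
  exact: integral0.
have mjoint a' b' S' : (a' <= n)%N -> (b' <= n)%N ->
    {in S', forall c, [&& c.1 < n, M <= c.2 & c.2 < N]%N} ->
    measurable_fun setT (fun w => (joint a' b' M S' w)%:R : R).
  move=> a'n b'n inS1; under eq_fun do rewrite !natrM.
  apply: measurable_funM; last by apply: measurable_all_occupied; exact: (inS' _ _ inS1).
  by apply: measurable_funM; apply: measurable_chain_count => //; exact: ltnW.
have inSM : {in S, forall c, [&& c.1 < n, M <= c.2 & c.2 < N]%N}.
  by move=> c /inS /and3P[-> /ltnW -> ->].
have newS i : (i, M) \notin S by apply/negP => /inS /= /and3P[_]; rewrite ltnn.
have inS1 i : (i < n)%N ->
    {in (i, M) :: S, forall c, [&& c.1 < n, M <= c.2 & c.2 < N]%N}.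
  move=> ilt c; rewrite in_cons => /predU1P[->|/inSM//].
  by rewrite /= ilt leqnn MN.
have uS1 i : uniq ((i, M) :: S) by rewrite /= newS uS.
rewrite pair_momentS; case: a b an bn => [|a] [|b] an bn /=.
- rewrite mulr0 addr0 -IH//; last exact: ltnW.
  by apply: eq_integral => w _; rewrite /joint /Z !chain_count0.
- rewrite mulrDl EFinD -IH//; last exact: ltnW.
  have -> : (p * pair_moment p M 0 b * p ^+ size S =
      pair_moment p M 0 b * p ^+ size ((b, M) :: S))%R by rewrite /= exprS; ring.
  rewrite -IH//; [|exact: ltnW|exact: ltnW|exact: inS1].
  rewrite -momentD; [|apply: mjoint => //|apply: mjoint => //; [exact: ltnW|exact: inS1]].
  apply: eq_integral => w _; rewrite /joint /Z !chain_count0 chain_countS /=.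
  by congr (_%:R%:E); rewrite -mulnb; lia.
- rewrite mulrDl EFinD -IH//; last exact: ltnW.
  have -> : (p * pair_moment p M a 0 * p ^+ size S =
      pair_moment p M a 0 * p ^+ size ((a, M) :: S))%R by rewrite /= exprS; ring.
  rewrite -IH//; [|exact: ltnW|exact: ltnW|exact: inS1].
  rewrite -momentD; [|apply: mjoint => //|apply: mjoint => //; [exact: ltnW|exact: inS1]].
  apply: eq_integral => w _; rewrite /joint /Z !chain_count0 chain_countS /=.
  by congr (_%:R%:E); rewrite -mulnb; lia.
(* If a = b, both chains use the same cell, which enters the list once; this is the factor 1 instead
   of p in [path_step]. *)
- pose Sab := if a == b then (a, M) :: S else (a, M) :: (b, M) :: S.
  have uSab : uniq Sab.
    rewrite /Sab; case: eqVneq => // ab; rewrite cons_uniq uS1 andbT in_cons negb_or newS.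
    by rewrite andbT; apply: contra ab => /eqP[->].
  have inSab : {in Sab, forall c, [&& c.1 < n, M <= c.2 & c.2 < N]%N}.
    rewrite /Sab; case: eqVneq => [_|_]; first exact: inS1.
    move=> c; rewrite in_cons => /predU1P[->|]; last exact: inS1.
    by rewrite /= an leqnn MN.
  have -> : ((pair_moment p M a.+1 b.+1 +
       p * (pair_moment p M a b.+1 + pair_moment p M a.+1 b +
            (if a == b then 1 else p) * pair_moment p M a b)) * p ^+ size S)%R =
      (pair_moment p M a.+1 b.+1 * p ^+ size S +
       pair_moment p M a b.+1 * p ^+ size ((a, M) :: S) +
       pair_moment p M a.+1 b * p ^+ size ((b, M) :: S) +
       pair_moment p M a b * p ^+ size Sab)%R.
    by rewrite /Sab; case: eqP => _ /=; rewrite !exprS; ring.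
  have [[a'n b'n] M'N] := (ltnW an, ltnW bn, ltnW MN).
  have [iSa iSb] := (inS1 a an, inS1 b bn).
  rewrite !EFinD -(IH a.+1 b.+1 S M'N an bn uS inSM).
  rewrite -(IH a b.+1 _ M'N a'n bn (uS1 a) iSa) -(IH a.+1 b _ M'N an b'n (uS1 b) iSb).
  rewrite -(IH a b _ M'N a'n b'n uSab inSab).
  rewrite -momentD; [|exact: mjoint|exact: mjoint].
  have m2 : measurable_fun setT
      (fun w => (joint a.+1 b.+1 M S w + joint a b.+1 M ((a, M) :: S) w)%N%:R : R).
    by under eq_fun do rewrite natrD; apply: measurable_funD; exact: mjoint.
  rewrite -momentD//; last exact: mjoint.
  rewrite -momentD//; last 2 first.
    by under eq_fun do rewrite natrD; apply: measurable_funD => //; exact: mjoint.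
    exact: mjoint.
  apply: eq_integral => w _; rewrite /joint /Z; congr (_%:R%:E).
  rewrite !chain_countS /Sab /=.
  have [->|_] := eqVneq a b; rewrite /= -!mulnb.
    by case: (occ w b M) => /=; lia.
  by case: (occ w a M); case: (occ w b M); case: (all_occupied w S) => /=; lia.
Qed.

(** At b = 0 this is the mean, as there is exactly one chain of length 0. *)
Lemma chain_count_second_moment a b : (a <= n)%N -> (b <= n)%N ->
  \int[P]_w (Z a N w * Z b N w)%:R%:E = (pair_moment p N a b)%:E.
Proof.
move=> an bn; have := @chain_count_joint_moment N a b [::].
rewrite mulr1 => <- //; apply: eq_integral => w _.
by rewrite /joint /= muln1.
Qed.

End chain_moments.

(** * Occupied cells of the Poisson process *)

Section poisson_occupation.
Context {R : realType}.
Implicit Types X A : set R.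

Lemma npoints_gt0P X A : finite_set X ->
  reflect (exists x, X x /\ A x) (0 < npoints X A)%N.
Proof.
move=> fX; have fXA : finite_set (X `&` A) by exact: finite_setIl.
rewrite /npoints cardfs_gt0; apply: (iffP (fset0Pn _)) => -[x].
  by rewrite in_fset_set// inE => -[]; exists x.
by move=> XAx; exists x; rewrite in_fset_set// inE.
Qed.

Lemma poisson_prob_set0 (mu : R) : 0 <= mu ->
  poisson_prob mu 0 [set 0%N] = (expR (- mu))%:E.
Proof.
rewrite /poisson_prob le_eqVlt => /predU1P[<-|mu0].
  by rewrite ltxx oppr0 expR0 diracE mem_set.
by rewrite mu0 esum_set1 ?lee_fin ?poisson_pmf_ge0// /poisson_pmf mu0 fact0 expr0 divr1 mul1r.
Qed.

Context {d : measure_display} {T : measurableType d}.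
Variables (P : probability T R) (D : set R) (lambda : R) (X : T -> set R).
Hypotheses (lambda_ge0 : 0 <= lambda) (X_poisson : poisson_process P D lambda X).

Definition hitting_prob (A : set R) : R := 1 - expR (- (lambda * fine (lebesgue_measure A))).

Lemma measurable_occupied A : measurable A -> A `<=` D ->
  measurable [set w | (0 < npoints (X w) A)%N].
Proof.
move=> mA AD; have := poisson_measurable X_poisson mA AD measurableT.
by move=> /(_ [set k | (0 < k)%N]); rewrite setTI; apply.
Qed.

Lemma prob_occupied A : measurable A -> A `<=` D ->
  P [set w | (0 < npoints (X w) A)%N] = (hitting_prob A)%:E.
Proof.
move=> mA AD; have mO := measurable_occupied mA AD.
have -> : [set w | (0 < npoints (X w) A)%N] =
    ~` ((fun w => npoints (X w) A) @^-1` [set 0%N]).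
  apply/seteqP; split => w /=; rewrite lt0n; first by move/eqP.
  by move=> /eqP.
rewrite probability_setC; last first.
  have := poisson_measurable X_poisson mA AD measurableT.
  by move=> /(_ [set 0%N]); rewrite setTI; apply.
have := poisson_law X_poisson mA AD [set 0%N]; rewrite /pushforward => ->.
rewrite poisson_prob_set0 ?mulr_ge0 ?fine_ge0 ?measure_ge0//.
Qed.

Lemma prob_all_occupied (n : nat) (A : 'I_n -> set R) :
  (forall i, measurable (A i)) -> (forall i, A i `<=` D) -> trivIset setT A ->
  P (\bigcap_i [set w | (0 < npoints (X w) (A i))%N]) =
  (\prod_(i < n) hitting_prob (A i))%:E.
Proof.
move=> mA AD dA.
have := poisson_independent X_poisson mA AD dA (fun _ => [set k | (0 < k)%N]).
rewrite /= -prodEFin => ->; apply: eq_bigr => i _.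
by rewrite -prob_occupied.
Qed.

End poisson_occupation.

Section cells.
Context {R : realType}.
Variables (r delta : R).

(** The coordinate u in window [i], measured back from the far end of the window. Windows are
    counted from 0. *)
Definition offset (i : nat) (x : R) : R := i.+1%:R * r - x.

Definition cell (i j : nat) : set R :=
  `]i.+1%:R * r - j.+1%:R * delta, i.+1%:R * r - j%:R * delta].

Lemma cellP i j x : cell i j x <-> j%:R * delta <= offset i x < j.+1%:R * delta.
Proof.
rewrite /cell /= in_itv/= /offset; split => /andP[h1 h2]; apply/andP; split; lra.
Qed.

Lemma measurable_cell i j : measurable (cell i j).
Proof. exact: measurable_itv. Qed.

Hypothesis delta_ge0 : 0 <= delta.

Lemma lebesgue_measure_cell i j : lebesgue_measure (cell i j) = delta%:E.
Proof.
rewrite /cell lebesgue_measure_itv/= lte_fin.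
have -> : i.+1%:R * r - j%:R * delta = i.+1%:R * r - j.+1%:R * delta + delta.
  rewrite -[j.+1%:R]natr1; ring.
rewrite ltrDl -EFinB addrAC subrr add0r lt_neqAle delta_ge0 andbT eq_sym.
by case: eqP => // ->.
Qed.

Variables (N : nat) (tau : R).
Hypotheses (Ndelta : N%:R * delta = tau) (tau_le : tau <= r).

Lemma offset_cell i j x : (j < N)%N -> cell i j x -> 0 <= offset i x < tau.
Proof.
move=> jN /cellP/andP[h1 h2]; rewrite (le_trans _ h1) ?mulr_ge0//=.
by rewrite (lt_le_trans h2)// -Ndelta ler_wpM2r// ler_nat.
Qed.

Lemma cell_sub k i j : (i < k)%N -> (j < N)%N -> cell i j `<=` `[0, k%:R * r].
Proof.
move=> ik jN x /(offset_cell jN); rewrite /offset /= in_itv/= => /andP[h1 h2].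
have tr := tau_le; have r0 : 0 <= r by lra.
have : r <= i.+1%:R * r by rewrite ler_peMl// ler1n.
have : i.+1%:R * r <= k%:R * r by rewrite ler_wpM2r// ler_nat.
by move=> *; apply/andP; split; lra.
Qed.

(** Offsets of one point in different windows differ by a nonzero multiple of r, yet both lie in [0,
    tau) with tau <= r. Within one window the columns are disjoint intervals. *)
Lemma cell_inj i j i' j' x : (j < N)%N -> (j' < N)%N ->
  cell i j x -> cell i' j' x -> (i, j) = (i', j').
Proof.
move=> jN j'N c c'.
have ltS m m' (e : R) : 0 <= e -> m%:R * e < m'.+1%:R * e -> (m <= m')%N.
  by move=> e0; rewrite -ltnS; case: leqP => // h; rewrite ltNge ler_wpM2r// ler_nat.
have oi := offset_cell jN c; have oi' := offset_cell j'N c'.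
have r0 : 0 <= r by move: oi => /andP[oi0 oi1]; exact: le_trans oi0 (le_trans (ltW oi1) tau_le).
have tr := tau_le.
have ii' : i = i'.
  apply/eqP; rewrite eqn_leq; move: oi oi' => /andP[h1 h2] /andP[h3 h4].
  by apply/andP; split; apply: (ltS _ _ r r0);
    move: h1 h2 h3 h4; rewrite /offset -[i.+1%:R]natr1 -[i'.+1%:R]natr1 => *; lra.
move: c c'; rewrite -ii' => /cellP/andP[h1 h2] /cellP/andP[h3 h4].
congr (_, _); apply/eqP; rewrite eqn_leq.
apply/andP; split; apply: (ltS _ _ delta delta_ge0).
- exact: le_lt_trans h1 h4.
- exact: le_lt_trans h3 h2.
Qed.

End cells.

Section dyadic_cells.
Context {R : realType} {d : measure_display} {T : measurableType d}.
Variables (P : probability T R) (r : R) (k : nat) (lambda : R) (X : T -> set R).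
Variables (tau : R) (n : nat).
Hypotheses (lambda_ge0 : 0 <= lambda)
  (X_poisson : poisson_process P `[0, k%:R * r] lambda X)
  (tau_ge0 : 0 <= tau) (tau_le : tau <= r) (nk : (n <= k)%N).

Definition mesh (m : nat) : R := tau / (2 ^ m)%:R.

Definition occ (m : nat) (w : T) (i j : nat) : bool :=
  (0 < npoints (X w) (cell r (mesh m) i j))%N.

Definition occ_prob (m : nat) : R := 1 - expR (- (lambda * mesh m)).

Lemma pow2_neq0 m : (2 ^ m)%:R != 0 :> R.
Proof. by rewrite pnatr_eq0 expn_eq0. Qed.

Lemma mesh_ge0 m : 0 <= mesh m.
Proof. by rewrite divr_ge0. Qed.

Lemma mesh_total m : (2 ^ m)%:R * mesh m = tau.
Proof. by rewrite mulrC divfK// pow2_neq0. Qed.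

Lemma meshS m : mesh m = 2 * mesh m.+1.
Proof.
by rewrite /mesh expnS natrM; field; rewrite pow2_neq0.
Qed.

Lemma cvg_mesh : mesh m @[m --> \oo] --> (0 : R).
Proof.
rewrite -[X in _ --> X](mulr0 tau); apply: cvgM; first exact: cvg_cst.
under eq_fun do rewrite natrX -exprVn.
by apply: cvg_expr; rewrite ger0_norm// invf_lt1// ltr1n.
Qed.

Lemma cell_sub_domain m i j : (i < n)%N -> (j < 2 ^ m)%N ->
  cell r (mesh m) i j `<=` `[0, k%:R * r].
Proof.
move=> ilt jlt; apply: (cell_sub (mesh_ge0 m) (mesh_total m) tau_le) => //.
exact: leq_trans ilt nk.
Qed.

Lemma measurable_occ m i j : (i < n)%N -> (j < 2 ^ m)%N ->
  measurable [set w | occ m w i j].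
Proof.
move=> ilt jlt; apply: (measurable_occupied X_poisson); first exact: measurable_cell.
exact: cell_sub_domain.
Qed.

Lemma measurable_fun_occ m i j : (i < n)%N -> (j < 2 ^ m)%N ->
  measurable_fun setT (fun w => (occ m w i j)%:R : R).
Proof.
move=> ilt jlt.
have : measurable_fun setT (\1_[set w | occ m w i j] : T -> R).
  by apply: measurable_indic; exact: measurable_occ.
by congr measurable_fun; apply/funext => w; rewrite indicE mem_setE.
Qed.

Lemma hitting_prob_cell m i j : hitting_prob lambda (cell r (mesh m) i j) = occ_prob m.
Proof. by rewrite /hitting_prob lebesgue_measure_cell ?mesh_ge0. Qed.

Lemma prob_occ m S : uniq S -> {in S, forall c, (c.1 < n)%N && (c.2 < 2 ^ m)%N} ->
  P [set w | all_occupied (occ m) w S] = (occ_prob m ^+ size S)%:E.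
Proof.
move=> uS inS; pose A (i : 'I_(size S)) :=
  cell r (mesh m) (nth (0, 0)%N S i).1 (nth (0, 0)%N S i).2.
have inA (i : 'I_(size S)) := inS _ (mem_nth (0, 0)%N (ltn_ord i)).
have mA i : measurable (A i) by exact: measurable_cell.
have AD i : A i `<=` `[0, k%:R * r].
  by have /andP[? ?] := inA i; apply: cell_sub_domain.
have dA : trivIset setT A.
  apply/trivIsetP => i j _ _ ij; rewrite -subset0 => x [Aix Ajx].
  have /andP[_ i2] := inA i; have /andP[_ j2] := inA j.
  have := cell_inj (mesh_ge0 m) (mesh_total m) tau_le i2 j2 Aix Ajx.
  rewrite -!surjective_pairing => /eqP; rewrite nth_uniq// => /eqP /val_inj.
  by move/eqP; rewrite (negbTE ij).
have := prob_all_occupied lambda_ge0 X_poisson mA AD dA.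
under eq_bigr do rewrite hitting_prob_cell.
rewrite prodr_const card_ord => <-; congr (P _).
apply/seteqP; split => w /=.
  by move=> /(all_nthP (0, 0)%N) wS i _ /=; apply: wS.
by move=> wS; apply/(all_nthP (0, 0)%N) => i iS; exact: (wS (Ordinal iS) I).
Qed.

Lemma homo_chain_count_occ w a : finite_set (X w) -> (a <= n)%N ->
  {homo (fun m => chain_count (occ m w) a (2 ^ m)) : m m' / (m <= m')%N}.
Proof.
move=> fX an; apply: homo_leq => [//|? ? ?|m]; first exact: leq_trans.
rewrite expnS mul2n; apply: (@leq_chain_count_double _ _ n (2 ^ m)) => // i j _ _.
move=> /npoints_gt0P[//|x [Xx /cellP/andP[h1 h2]]].
(* The midpoint of the coarse cell decides which half holds the point. *)
have [h|h] := ltP (offset r i x) (j.*2.+1%:R * mesh m.+1).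
  apply/orP; left; apply/npoints_gt0P => //; exists x; split => //; apply/cellP.
  by rewrite h andbT -muln2 natrM -mulrA -meshS.
apply/orP; right; apply/npoints_gt0P => //; exists x; split => //; apply/cellP.
by rewrite h/= -doubleS -muln2 natrM -mulrA -meshS.
Qed.

Lemma cvg_occ_prob : occ_prob m @[m --> \oo] --> (0 : R).
Proof.
rewrite /occ_prob -[X in _ --> X](subrr 1); apply: cvgB; first exact: cvg_cst.
rewrite -[X in _ --> X]expR0 -oppr0 -(mulr0 lambda).
apply: continuous_cvg; first exact: continuous_expR.
by apply: cvgN; apply: cvgM; [exact: cvg_cst|exact: cvg_mesh].
Qed.

Lemma cvg_mean_occ : (2 ^ m)%:R * occ_prob m @[m --> \oo] --> lambda * tau.
Proof.
have lm m : 0 <= lambda * mesh m by rewrite mulr_ge0 ?mesh_ge0.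
have E m : (2 ^ m)%:R * (lambda * mesh m) = lambda * tau.
  by rewrite mulrCA mesh_total.
(* Squeeze from y / (1 + y) <= 1 - exp(-y) <= y at y = [lambda * mesh m], multiplied by 2^m, where
   2^m y = lambda tau. *)
apply: (@squeeze_cvgr _ _ _ _ (fun m => lambda * tau / (1 + lambda * mesh m)) (cst (lambda * tau))).
- near=> m; apply/andP; split.
    rewrite -(E m) -mulrA ler_wpM2l// /occ_prob.
    have e0 := expR_gt0 (lambda * mesh m).
    have e1 := expR_ge1Dx (lambda * mesh m).
    have lm0 := lm m.
    rewrite expRN ler_pdivrMr ?ltr_pwDl//.
    have : (expR (lambda * mesh m))^-1 <= (1 + lambda * mesh m)^-1.
      by rewrite lef_pV2 ?posrE ?ltr_pwDl.
    rewrite -(ler_pM2r (x := 1 + lambda * mesh m)) ?ltr_pwDl// mulVf ?gt_eqF ?ltr_pwDl//.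
    lra.
  rewrite /= -(E m) ler_wpM2l// /occ_prob.
  by have := expR_ge1Dx (- (lambda * mesh m)); lra.
- rewrite -[X in _ --> X]divr1; apply: cvgM; first exact: cvg_cst.
  apply: cvgV; rewrite ?oner_eq0// -[X in _ --> X]addr0 -(mulr0 lambda).
  by apply: cvgD; [exact: cvg_cst|apply: cvgM; [exact: cvg_cst|exact: cvg_mesh]].
- exact: cvg_cst.
Unshelve. all: by end_near. Qed.

End dyadic_cells.

(** * Paths as chains of cells *)

Section hop_chains.
Context {R : realType}.
Variables (r : R) (X : set R).

Definition hop_step (x y : R) : bool := (x < y) && (y - x <= r).

Definition hops (a : nat) (t : R) : set (seq R) :=
  [set s | [/\ size s = a, forall x, x \in s -> X x & path hop_step 0 (rcons s t)]].

(** Lists of points with 0 <= u_1 < ... < u_a < v, each offset taken in its own window. The last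
    point is split off, to match the recursion of [chain_count]. *)
Fixpoint offset_chains (a : nat) (v : R) : set (seq R) :=
  if a is a'.+1 then
    [set t | exists s y, [/\ t = rcons s y, X y, 0 <= offset r a' y < v
      & offset_chains a' (offset r a' y) s]]
  else [set [::]].

(** The a + 1 hops have length at most r each, so t <= (a + 1) r. *)
Lemma hops_offset_ge0 a t s : hops a t s -> 0 <= offset r a t.
Proof.
elim/last_ind: s a t => [|s y IH] [|a] t [] //.
- by move=> _ _ /=; rewrite andbT /hop_step /offset mul1r subr0 subr_ge0 => /andP[].
- by rewrite size_rcons.
- rewrite size_rcons => -[sa] sX; rewrite rcons_path last_rcons => /andP[ps /andP[_ h]].
  have : 0 <= offset r a y.
    apply: IH; split => // x xs; apply: sX; by rewrite mem_rcons in_cons xs orbT.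
  by rewrite /offset -[a.+2%:R]natr1 -natr1; lra.
Qed.

Variables (n : nat) (tau : R).
Hypotheses (tau_le : tau <= r)
  (no_end : forall i x, (i < n)%N -> X x -> offset r i x != 0 /\ offset r i x != tau)
  (no_tie : forall i j x y, (i < n)%N -> (j < n)%N -> i != j -> X x -> X y ->
     0 <= offset r i x < tau -> offset r i x != offset r j y).

(** A hop from offset u to offset v in the next window has length r + u - v. It is at most r iff u
    <= v, and positive iff v - u < r, which follows from 0 < u and v <= r. Ties being excluded, u <
    v is all that remains. The alternative on v distinguishes a next point in [X] from the final
    target, where v = tau. *)
Lemma hops_offset_chains a v : (a <= n)%N -> 0 <= v ->
  [\/ [/\ v < tau, (a < n)%N & X (a.+1%:R * r - v)] |
      [/\ v = tau, a = n & (0 < n)%N]] ->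
  hops a (a.+1%:R * r - v) = offset_chains a v.
Proof.
have tr := tau_le.
elim: a v => [|a IH] v an v0 hv.
  apply/seteqP; split => s /=; first by case=> /size0nil.
  move=> ->; split => //=; rewrite andbT /hop_step mul1r subr0.
  have vr : v < r by case: hv => -[]; [lra|move=> _ <-].
  by apply/andP; split; lra.
have vtau : v <= tau by case: hv => -[]; [move=> /ltW|move=> ->].
have stepE y u : u = offset r a y ->
    hop_step y (a.+2%:R * r - v) = (v - u < r) && (u <= v).
  move=> ->; rewrite /hop_step /offset -[a.+2%:R]natr1.
  by congr andb; apply/idP/idP => *; lra.
have strict y : X y -> 0 <= offset r a y -> offset r a y <= v ->
    0 < offset r a y < v.
  move=> Xy u0 uv; have [ne0 net] := no_end an Xy.
  rewrite lt_def ne0 u0 /= lt_neqAle uv andbT.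
  case: hv => [[vt an' Xv]|[-> //]].
  have aS : a != a.+1 by rewrite neq_ltn ltnSn.
  have := no_tie an an' aS Xy Xv.
  rewrite u0 (le_lt_trans uv vt) => /(_ isT).
  by rewrite [offset r a.+1 _]/offset opprB addrCA subrr addr0.
have IHy y : X y -> 0 <= offset r a y -> offset r a y <= v ->
    hops a y = offset_chains a (offset r a y).
  move=> Xy u0 uv; have /andP[_ ltuv] := strict y Xy u0 uv.
  have yE : a.+1%:R * r - offset r a y = y by rewrite /offset opprB addrCA subrr addr0.
  rewrite -[in LHS]yE; apply: IH => //; first exact: ltnW.
  by left; rewrite yE; split => //; exact: lt_le_trans ltuv vtau.
apply/seteqP; split => s /=.
  case/lastP: s => [[]//|s y].
  rewrite /hops /= size_rcons => -[[sa] sX]; rewrite rcons_path last_rcons => /andP[ps step].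
  have Xy : X y by apply: sX; rewrite mem_rcons mem_head.
  have hs : hops a y s.
    by split => // x xs; apply: sX; rewrite mem_rcons in_cons xs orbT.
  have u0 := hops_offset_ge0 hs.
  have := step; rewrite (stepE y _ erefl) => /andP[_ uv].
  exists s, y; split => //.
    by have /andP[_ ->] := strict y Xy u0 uv; rewrite u0.
  by rewrite -IHy.
move=> [s' [y [-> Xy /andP[u0 uv]]]].
rewrite -IHy// ?ltW// => -[sa sX ps]; split.
- by rewrite size_rcons sa.
- by move=> x; rewrite mem_rcons in_cons => /predU1P[->|/sX].
- have /andP[u_gt0 _] := strict y Xy u0 (ltW uv).
  by rewrite rcons_path last_rcons ps (stepE y _ erefl) (ltW uv) andbT /=; lra.
Qed.

Hypothesis finX : finite_set X.

Lemma finite_offset_chains a v : finite_set (offset_chains a v).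
Proof.
elim: a v => [|a IH] v /=; first exact: finite_set1.
apply: (@sub_finite_set _ _ (\bigcup_(y in X)
    (fun s => rcons s y) @` offset_chains a (offset r a y))).
  by move=> _ [s [y [-> Xy _ cs]]]; exists y => //; exists s.
by apply: bigcup_finite => // y _; apply: finite_image; exact: IH.
Qed.

Lemma khop_count_offset_chains : (0 < n)%N -> 0 <= tau ->
  khop_count r n.+1 X (n.+1%:R * r - tau) =
  #|` fset_set (offset_chains n tau)|%fset.
Proof.
move=> n0 tau0; rewrite /khop_count.
have hopsE := hops_offset_chains (leqnn n) tau0 (or_intror (And3 erefl erefl n0)).
have -> : khops r n.+1 X (n.+1%:R * r - tau) =
    (fun s : n.-tuple R => tval s) @^-1` offset_chains n tau.
  rewrite -hopsE; apply/seteqP; split => s /=.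
    by move=> [sX ps]; split => //; rewrite size_tuple.
  by move=> [_ sX ps].
have finK : finite_set ((fun s : n.-tuple R => tval s) @^-1` offset_chains n tau).
  apply: finite_preimage; last exact: finite_offset_chains.
  by move=> s s' _ _; exact: val_inj.
have {2}<- : (fun s : n.-tuple R => tval s) @`
    ((fun s : n.-tuple R => tval s) @^-1` offset_chains n tau) = offset_chains n tau.
  rewrite -hopsE; apply/seteqP; split => s /=; first by move=> [s' hs <-].
  by move=> hs; have [/eqP sn _ _] := hs; exists (Tuple sn).
by rewrite fset_set_image// card_imfset//=; exact: val_inj.
Qed.

Variables (delta : R) (N : nat).
Hypothesis (separated : forall i j l x y, (i < n)%N -> (j < n)%N -> (l < N)%N ->
  X x -> X y -> cell r delta i l x -> cell r delta j l y -> i = j /\ x = y).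

(** Induction on the columns: the last point either lies before column M or in it, and [separated]
    leaves a single candidate for the latter. *)
Lemma card_offset_chains a M : 0 <= delta -> (a <= n)%N -> (M <= N)%N ->
  #|` fset_set (offset_chains a (M%:R * delta))|%fset =
  chain_count (fun i j => (0 < npoints X (cell r delta i j))%N) a M.
Proof.
move=> delta0.
elim: M a => [|M IH] [|a] an MN; rewrite ?chain_count0.
- by rewrite fset_set1 cardfs1.
- rewrite [X in fset_set X](_ : _ = set0) ?fset_set0 ?cardfs0//.
  by rewrite -subset0 => s /= [? [y [_ _]]]; rewrite mul0r; case: leP => //= /le_gtF ->.
- by rewrite fset_set1 cardfs1.
have MS : M%:R * delta <= M.+1%:R * delta by rewrite ler_wpM2r// ler_nat.
rewrite chain_countS -(IH _ an (ltnW MN)) -(IH _ (ltnW an) (ltnW MN)).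
have [/npoints_gt0P-/(_ finX)[y0 [Xy0 cy0]]|noX] := boolP (0 < _)%N; last first.
  rewrite mul0n addn0; congr #|` fset_set _|%fset.
  apply/seteqP; split => _ /= [s [y [-> Xy /andP[h1 h2] cs]]]; exists s, y; split => //.
    rewrite h1 /=; case: ltP => // h3; case/negP: noX; apply/npoints_gt0P => //.
    by exists y; split => //; apply/cellP; rewrite h2 h3.
  by rewrite h1 (lt_le_trans h2).
have /andP[c1 c2] := (cellP _ _ _ _ _).1 cy0.
(* No other window has a point in the column of [y0], so an earlier point has offset below that of
   [y0] iff it has offset below M delta. *)
have cE : offset_chains a (offset r a y0) = offset_chains a (M%:R * delta).
  case: a an cy0 c1 c2 => // a an cy0 c1 c2.
  apply/seteqP; split => _ /= [s [y [-> Xy /andP[h1 h2] cs]]]; exists s, y; split => //.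
    rewrite h1 /=; case: ltP => // h3.
    have cy : cell r delta a M y by apply/cellP; rewrite h3 (lt_trans h2).
    by have [/esym/eqP] := separated (ltnW an) an MN Xy Xy0 cy cy0; rewrite (gtn_eqF (ltnSn a)).
  by rewrite h1 (lt_le_trans h2).
have -> : offset_chains a.+1 (M.+1%:R * delta) = offset_chains a.+1 (M%:R * delta) `|`
    (fun s => rcons s y0) @` offset_chains a (M%:R * delta).
  rewrite -cE; apply/seteqP; split => [_ /= [s [y [-> Xy /andP[h1 h2] cs]]]|].
    have [h3|h3] := ltP (offset r a y) (M%:R * delta).
      by left; exists s, y; rewrite h1 h3.
    have cy : cell r delta a M y by apply/cellP; rewrite h3.
    have [_ yE] := separated an an MN Xy Xy0 cy cy0.
    by right; exists s; rewrite -yE.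
  move=> _ /= [[s [y [-> Xy /andP[h1 h2] cs]]]|[s cs <-]].
    by exists s, y; rewrite h1 (lt_le_trans h2 MS).
  exists s, y0; split => //; rewrite c2 andbT.
  by rewrite (le_trans _ c1)// mulr_ge0.
have inj_rcons : injective (fun s : seq R => rcons s y0).
  by move=> s s' /rcons_inj[].
rewrite fset_setU; [|exact: finite_offset_chains|]; last first.
  by apply: finite_image; exact: finite_offset_chains.
rewrite mul1n fset_set_image; last exact: finite_offset_chains.
(* The union is disjoint: a common chain would end at [y0] with offset below M delta. *)
rewrite cardfsU [X in (_ - #|` X|)%N](_ : _ = fset0)%fset.
  by rewrite cardfs0 subn0 card_imfset.
apply/eqP; rewrite -fsubset0; apply/fsubsetP => s.
rewrite in_fsetI => /andP[]; rewrite in_fset_set ?inE; last exact: finite_offset_chains.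
move=> [s' [y [-> Xy /andP[_ h] _]]] /imfsetP[/= s'' _ /rcons_inj[_ yy0]].
by move: h; rewrite yy0 ltNge c1.
Qed.

End hop_chains.

Lemma near_all_seq {I : Type} {J : eqType} {F : set_system I} {FF : Filter F}
    (s : seq J) (Q : J -> I -> Prop) :
  (forall x, x \in s -> \forall m \near F, Q x m) ->
  \forall m \near F, forall x, x \in s -> Q x m.
Proof.
elim: s => [|y s IH] Qs; first exact: nearW.
have Qy := Qs y (mem_head _ _).
have := IH (fun x xs => Qs x (mem_behead (s := y :: s) xs)).
apply: filterS2 Qy => m Qy Qs' x; rewrite in_cons => /predU1P[->//|]; exact: Qs'.
Qed.

Lemma dyadic_locate {R : realType} (tau : R) (m : nat) (u : R) : 0 <= tau -> 0 <= u -> u < tau ->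
  exists2 l, (l < 2 ^ m)%N & l%:R * mesh tau m <= u < l.+1%:R * mesh tau m.
Proof.
move=> tau0 u0 ut; have tau_gt0 : 0 < tau := le_lt_trans u0 ut.
have mesh_gt0 : 0 < mesh tau m by rewrite divr_gt0// ltr0n expn_gt0.
have /truncn_itv/andP[l1 l2] : 0 <= u / mesh tau m by rewrite divr_ge0// ltW.
exists (Num.truncn (u / mesh tau m)); last by rewrite -ler_pdivlMr// l1 -ltr_pdivrMr.
rewrite -(ltr_nat R); apply: le_lt_trans l1 _.
by rewrite ltr_pdivrMr// mesh_total.
Qed.

(** * The exceptional null event *)

Section exceptional_set.
Context {R : realType} {d : measure_display} {T : measurableType d}.
Variables (P : probability T R) (r : R) (k : nat) (lambda : R) (X : T -> set R).
Variables (tau : R) (n : nat).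
Hypotheses (lambda_ge0 : 0 <= lambda)
  (X_poisson : poisson_process P `[0, k%:R * r] lambda X)
  (tau_ge0 : 0 <= tau) (tau_le : tau <= r) (nk : (n <= k)%N).

Local Notation occ := (occ r X tau).
Local Notation occ_prob := (occ_prob lambda tau).

(** A single point has Lebesgue measure 0, so it is hit with probability 1 - exp(0) = 0. *)
Lemma negligible_point (x : R) : `[0, k%:R * r]%classic x -> P.-negligible [set w | X w x].
Proof.
move=> Dx; have mx : measurable [set x] by exact: measurable_set1.
have xD : [set x] `<=` `[0, k%:R * r] by move=> _ ->.
have := prob_occupied lambda_ge0 X_poisson mx xD.
rewrite /hitting_prob lebesgue_measure_set1 mulr0 oppr0 expR0 subrr.
move=> P0; exists [set w | (0 < npoints (X w) [set x])%N]; split => //.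
  exact: (measurable_occupied X_poisson).
move=> w /= Xx; apply/npoints_gt0P; first exact: poisson_finite X_poisson w.
by exists x.
Qed.

(** Equal offsets in [0, tau) force a common occupied column at every level, an event made of cells
    of known probability. *)
Definition tie_at (m : nat) (i j : nat) (w : T) : Prop :=
  exists2 l, (l < 2 ^ m)%N & occ m w i l && occ m w j l.

(** Each of the 2^m columns is shared with probability p^2. By the union bound a tie at level m has
    probability at most 2^m p^2, which tends to 0 because 2^m p tends to lambda tau and p to 0. *)
Lemma negligible_tie i j : (i < n)%N -> (j < n)%N -> i != j ->
  P.-negligible [set w | forall m, tie_at m i j w].
Proof.
move=> ilt jlt ij.
pose E m := \big[setU/set0]_(l < 2 ^ m) [set w | occ m w i l && occ m w j l].
have EP m : [set w | tie_at m i j w] = E m.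
  rewrite /E -(bigcup_mkord (2 ^ m) (fun l => [set w | occ m w i l && occ m w j l])).
  by apply/seteqP; split => w /= [l ? ?]; exists l.
have mO m l : (l < 2 ^ m)%N -> measurable [set w | occ m w i l && occ m w j l].
  move=> llt; rewrite (_ : [set _ | _] = [set w | occ m w i l] `&` [set w | occ m w j l]).
    by apply: measurableI; apply: (measurable_occ X_poisson tau_ge0 tau_le nk).
  by apply/seteqP; split => w /= /andP.
have mE m : measurable (E m) by apply: bigsetU_measurable => l _; exact: mO.
have PE m : (P (E m) <= ((2 ^ m)%:R * occ_prob m * occ_prob m)%:E)%E.
  apply: le_trans (Boole_inequality P (mO m)) _.
  rewrite (eq_bigr (fun=> (occ_prob m ^+ 2)%:E)).
    by rewrite sumEFin lee_fin sumr_const card_ord -[leRHS]mulrA -expr2 mulr_natl.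
  move=> l _.
  have := prob_occ lambda_ge0 X_poisson tau_ge0 tau_le nk
    (S := [:: (i, l : nat); (j, l : nat)]) (m := m).
  rewrite /= /all_occupied /= andbT => <- //.
  - by congr (P _); apply/funext => w /=; rewrite andbT.
  - by rewrite inE; apply: contra ij => /eqP[->].
  - by move=> c; rewrite !inE => /orP[] /eqP -> /=; rewrite ?ilt ?jlt ltn_ord.
exists (\bigcap_m E m); split.
- exact: bigcap_measurable.
- have mC : measurable (\bigcap_m E m) by exact: bigcap_measurable.
  have Pfin := fin_num_measure P _ mC.
  rewrite -(fineK Pfin); congr (_%:E); apply/eqP; rewrite eq_le fine_ge0 ?andbT//.
  have lim0 : (2 ^ m)%:R * occ_prob m * occ_prob m @[m --> \oo] --> (0 : R).
    rewrite -[X in _ --> X](mulr0 (lambda * tau)); apply: cvgM.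
      exact: cvg_mean_occ.
    exact: cvg_occ_prob.
  rewrite -(cvg_lim (@Rhausdorff R) lim0); apply: limr_ge; first exact: cvgP lim0.
  near=> m.
  rewrite -lee_fin fineK//; apply: le_trans (PE m).
  by apply: le_measure; rewrite ?inE//; exact: bigcap_inf.
- by move=> w /= wtie m _; rewrite -EP; exact: wtie.
Unshelve. all: by end_near. Qed.

(** Off this event the hypotheses [no_end] and [no_tie] of the deterministic comparison hold. *)
Definition exceptional : set T :=
  [set w | exists i, (i < n)%N /\ (X w (i.+1%:R * r) \/ X w (i.+1%:R * r - tau))] `|`
  [set w | exists i j, [/\ (i < n)%N, (j < n)%N, i != j & forall m, tie_at m i j w]].

Lemma negligible_exceptional : P.-negligible exceptional.
Proof.
have r_ge0 : 0 <= r by exact: le_trans tau_le.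
apply: negligibleU.
  rewrite (_ : [set _ | _] = \bigcup_i [set w | (i < n)%N /\
      (X w (i.+1%:R * r) \/ X w (i.+1%:R * r - tau))]); last first.
    by apply/seteqP; split => w /= [i]; [exists i|exists i].
  apply: negligible_bigcup => i.
  have [ilt|_] := boolP (i < n)%N; last first.
    by apply: negligibleS (negligible_set0 P) => w [].
  have ir : r <= i.+1%:R * r by rewrite ler_peMl// ler1n.
  have ikr : i.+1%:R * r <= k%:R * r.
    by rewrite ler_wpM2r// ler_nat (leq_trans ilt).
  have tr := tau_le; have t0 := tau_ge0.
  apply: negligibleS (negligibleU (negligible_point (x := i.+1%:R * r) _)
    (negligible_point (x := i.+1%:R * r - tau) _)).
  - by move=> w [_].
  - by rewrite /= in_itv/=; apply/andP; split; lra.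
  - by rewrite /= in_itv/=; apply/andP; split; lra.
rewrite (_ : [set _ | _] = \bigcup_i \bigcup_j [set w |
   [/\ (i < n)%N, (j < n)%N, i != j & forall m, tie_at m i j w]]); last first.
  apply/seteqP; split => w /=; first by move=> [i [j H]]; exists i => //; exists j.
  by move=> [i _ [j _ H]]; exists i, j.
apply: negligible_bigcup => i; apply: negligible_bigcup => j.
have [/and3P[ilt jlt ij]|H] := boolP [&& i < n, j < n & i != j]%N.
  by apply: negligibleS (negligible_tie ilt jlt ij) => w [].
by apply: negligibleS (negligible_set0 P) => w [ilt jlt ij]; case/and3P: H.
Qed.

Lemma no_tie_off_exceptional w : ~ exceptional w ->
  forall i j x y, (i < n)%N -> (j < n)%N -> i != j -> X w x -> X w y ->
    0 <= offset r i x < tau -> offset r i x != offset r j y.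
Proof.
move=> Nw i j x y ilt jlt ij Xx Xy /andP[u0 ut]; apply/eqP => eqo; apply: Nw; right.
have fX := poisson_finite X_poisson w.
exists i, j; split => // m; have [l llt lP] := dyadic_locate m tau_ge0 u0 ut.
exists l => //; apply/andP; split; apply/npoints_gt0P => //.
  by exists x; split => //; apply/cellP.
by exists y; split => //; apply/cellP; rewrite -eqo.
Qed.

(** Only finitely many pairs of a window and a point occur, so the mesh eventually falls below every
    positive gap between their offsets. Equal offsets in one window mean equal points; in two
    windows, inside [0, tau), they would be a tie. *)
Lemma separated_eventually w : ~ exceptional w ->
  \forall m \near \oo, forall i j l x y, (i < n)%N -> (j < n)%N -> (l < 2 ^ m)%N ->
    X w x -> X w y -> cell r (mesh tau m) i l x -> cell r (mesh tau m) j l y ->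
    i = j /\ x = y.
Proof.
move=> Nw; have /finite_seqP[s Xs] := poisson_finite X_poisson w.
pose Q (c : (nat * R) * (nat * R)) (m : nat) := forall l, (l < 2 ^ m)%N ->
  cell r (mesh tau m) c.1.1 l c.1.2 -> cell r (mesh tau m) c.2.1 l c.2.2 ->
  c.1.1 = c.2.1 /\ c.1.2 = c.2.2.
pose S := [seq (i, x) | i <- iota 0 n, x <- s].
have inS i x : (i < n)%N -> X w x -> (i, x) \in S.
  by move=> ilt; rewrite Xs => xs; apply/allpairsP; exists (i, x); rewrite /= mem_iota.
have : \forall m \near \oo, forall c, c \in [seq (a, b) | a <- S, b <- S] -> Q c m.
  apply: near_all_seq => _ /allpairsP[[a b] /= [aS bS ->]].
  have /allpairsP[[i x] /= [ilt xs ->]] := aS.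
  have /allpairsP[[j y] /= [jlt ys ->]] := bS.
  rewrite !mem_iota /= add0n in ilt jlt.
  have Xx : X w x by rewrite Xs.
  have Xy : X w y by rewrite Xs.
  have [eqo|neqo] := eqVneq (offset r i x) (offset r j y).
    have [ij|ij] := eqVneq i j.
      near=> m => l _ _ _ /=; split => //; move: eqo; rewrite /offset ij => /subrI.
      exact.
    near=> m => l llt /= cx cy; exfalso.
    have u0t := offset_cell (mesh_ge0 tau_ge0 m) (mesh_total tau m) llt cx.
    by have := no_tie_off_exceptional Nw ilt jlt ij Xx Xy u0t; rewrite eqo eqxx.
  have : \forall m \near \oo, mesh tau m < `|offset r i x - offset r j y|.
    apply: (cvgr_lt _ (cvg_mesh tau)); rewrite normr_gt0 subr_eq0//.
  apply: filterS => m mlt l llt /= /cellP/andP[h1 h2] /cellP/andP[h3 h4].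
  move: mlt; rewrite ltNge => /negP; case.
  move: h2 h4; rewrite -natr1 => h2 h4; rewrite ler_norml; apply/andP; split; lra.
apply: filterS => m Qm i j l x y ilt jlt llt Xx Xy cx cy.
apply: (Qm ((i, x), (j, y))) llt cx cy.
by apply/allpairsP; exists ((i, x), (j, y)); rewrite /= !inS.
Unshelve. all: by end_near. Qed.

Lemma chain_count_occ_eventually w : ~ exceptional w -> k = n.+1 -> (0 < n)%N ->
  \forall m \near \oo,
    chain_count (occ m w) n (2 ^ m) = khop_count r k (X w) (k%:R * r - tau).
Proof.
move=> Nw kn n0; have fX := poisson_finite X_poisson w.
have no_end i x : (i < n)%N -> X w x -> offset r i x != 0 /\ offset r i x != tau.
  move=> ilt Xx; split; apply/eqP => h; apply: Nw; left; exists i; split => //.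
    by left; rewrite (subr0_eq h).
  by right; rewrite -h /offset opprB addrCA subrr addr0.
have no_tie := no_tie_off_exceptional Nw.
apply: filterS (separated_eventually Nw) => m sep.
rewrite kn (khop_count_offset_chains tau_le no_end no_tie fX)//.
by rewrite -{2}(mesh_total tau m) (card_offset_chains fX sep)// mesh_ge0.
Qed.

End exceptional_set.

Theorem corollary4p3 (R : realType) (d : measure_display) (T : measurableType d)
    (P : probability T R) (r : R) (r_gt0 : 0 < r)
    (k : nat) (k_ge2 : (2 <= k)%N)
    (lambda : R) (lambda_gt0 : 0 < lambda)
    (X : T -> set R)
    (X_poisson : poisson_process P `[0, k%:R * r] lambda X)
    (tau : R) (tau_ge0 : 0 <= tau) (tau_le : tau <= r) :
  ('V_P[(fun w : T => (khop_count r k (X w) (k%:R * r - tau))%:R : R)] =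
   ((k - 1)`!%:R^-1 *
    \sum_(0 <= l < k - 1)
       'C(k - 1, l)%:R * (lambda * tau) ^+ (k - 1 + l) *
       (Gamma ((k - 1 - l)%:R / 2 + 1) / Gamma ((k - 1 + l)%:R / 2 + 1)))%:E)%E.
Proof.
have lambda_ge0 := ltW lambda_gt0.
have n0 : (0 < k - 1)%N by rewrite subn_gt0.
have kn : k = (k - 1).+1 by rewrite subn1 prednK// ltnW.
have nk : (k - 1 <= k)%N by rewrite leq_subr.
move: (k - 1)%N n0 kn nk => n n0 kn nk.
have [N [mN PN excN]] := negligible_exceptional lambda_ge0 X_poisson tau_ge0 tau_le nk.
have moment m a b : (a <= n)%N -> (b <= n)%N ->
    (\int[P]_w (chain_count (occ r X tau m w) a (2 ^ m) *
      chain_count (occ r X tau m w) b (2 ^ m))%:R%:E =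
    (pair_moment (occ_prob lambda tau m) (2 ^ m) a b)%:E)%E.
  move=> an bn; apply: (chain_count_second_moment (n := n)) => //.
    by move=> i j; exact: (measurable_fun_occ X_poisson tau_ge0 tau_le nk).
  by move=> S; exact: (prob_occ lambda_ge0 X_poisson tau_ge0 tau_le nk).
(* Used at b = 0 for the mean and at b = n for the second moment. *)
have limit a b : (a <= n)%N -> (b <= n)%N ->
    (\int[P]_w (chain_count (occ r X tau m w) a (2 ^ m) *
      chain_count (occ r X tau m w) b (2 ^ m))%:R%:E)%E @[m --> \oo] -->
    (\sum_(q < (a + b).+1) (lambda * tau) ^+ q / q`!%:R * path_weight 0 q a b)%:E.
  move=> an bn; under eq_fun do rewrite moment//.
  apply/fine_cvgP; split; first exact: nearW.
  exact: (@cvg_pair_moment _ _ _ _ a b (cvg_occ_prob lambda tau)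
    (cvg_mean_occ lambda_ge0 tau_ge0)).
rewrite -variance_sum//; apply: (variance_limit
  (Z := fun m w => chain_count (occ r X tau m w) n (2 ^ m)) mN PN).
- move=> m; apply: (measurable_chain_count (n := n) (N := 2 ^ m)) => //.
  by move=> i j; exact: (measurable_fun_occ X_poisson tau_ge0 tau_le nk).
- by move=> w; apply: homo_chain_count_occ (leqnn n); exact: poisson_finite X_poisson w.
- move=> w Nw; apply: (chain_count_occ_eventually X_poisson tau_ge0 tau_le) => //.
  by move=> /excN.
- have := limit n 0%N (leqnn n) isT.
  by under eq_fun do under eq_integral do rewrite chain_count0 muln1.
- by have := limit n n (leqnn n) (leqnn n).
Qed.
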